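(* Let $p\in\mathcal P^{\delta\times\delta}$ be symmetric with $p(0)$ invertible and with $\mathcal D_p$ bounded. If $\mathcal D_p$ is convex, then there is a monic linear pencil $L$ (of finite size) such that $\mathcal D_p(n)=\mathcal D_L(n)$ for every positive integer $n$. That is, if $p\in\mathcal P^{\delta\times\delta}$ is symmetric, $p(0)$ is invertible, and $\mathcal D_p$ is bounded, then $\mathcal D_p$ is convex if and only if the graded set $\mathcal D_p$ has an LMI representation.
   Context: Fix a positive integer $g$. $\mathcal P$ denotes the free algebra of polynomials with real coefficients in freely noncommuting variables $x=(x_1,\dots,x_g)$, and $\mathcal P^{\delta\times\delta'}$ the $\delta\times\delta'$ matrices over $\mathcal P$. Write $p\in\mathcal P^{\delta\times\delta'}$ as a finite sum $p=\sum_w p_w w$ over words $w$ in the $x_j$ with $p_w$ real $\delta\times\delta'$ matrices. The involution is $p^T=\sum_w p_w^T w^T$, where $w^T$ is the reversed word (so $x_j^T=x_j$); $p\in\mathcal P^{\delta\times\delta}$ is symmetric if $p^T=p$. $\mathbb S_n(\mathbb R^g)$ is the set of $g$-tuples $X=(X_1,\dots,X_g)$ of real symmetric $n\times n$ matrices. For such $X$, $p(X)=\sum_w p_w\otimes w(X)$, where $w(X)=X_{j_1}\cdots X_{j_k}$ for $w=x_{j_1}\cdots x_{j_k}$ and $\emptyset(X)=I_n$. In particular $p(0)=p_\emptyset$, a $\delta\times\delta$ matrix. A graded set is a sequence $\mathcal S=(\mathcal S(n))_{n\ge1}$ with $\mathcal S(n)\subset\mathbb S_n(\mathbb R^g)$;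 equality and inclusion are termwise. For symmetric $p$ with $p(0)$ invertible, the invertibility set $\mathcal D_p=(\mathcal D_p(n))_n$ is the graded set in which $\mathcal D_p(n)$ is the connected component containing $0$ of $\{X\in\mathbb S_n(\mathbb R^g): p(X)\text{ is invertible}\}$. A graded set is convex if each $\mathcal S(n)$ is convex, and bounded if there is a constant $K$ with $\|X\|:=\sum_j\|X_j\|\le K$ for all $n$ and all $X\in\mathcal S(n)$. A monic linear pencil of size $\ell$ is $L(x)=I_\ell+\sum_{j=1}^g A_jx_j$ with $A_j$ real symmetric $\ell\times\ell$ matrices; then $\mathcal D_L(n)=\{X\in\mathbb S_n(\mathbb R^g): L(X)\succ0\}$. A graded set $\mathcal C$ has an LMI representation if $\mathcal C=\mathcal D_L$ for some monic linear pencil $L$. *)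

(* Defs.v *)
From HB Require Import structures.
From mathcomp Require Import all_boot all_order all_algebra finmap.
From mathcomp Require Import monalg.
From mathcomp Require Import mxtens.
From mathcomp Require Import boolp classical_sets functions reals.
From mathcomp Require Import topology normedtype convex.

Set Implicit Arguments.
Unset Strict Implicit.
Unset Printing Implicit Defensive.

Import Order.TTheory GRing.Theory Num.Theory.
Import numFieldNormedType.Exports.

Local Open Scope classical_set_scope.
Local Open Scope ring_scope.

(* [:: j1; ...; jk] stands for the word x_{j1} ... x_{jk}. *)
Definition word (g : nat) : Type := seq 'I_g.

HB.instance Definition _ (g : nat) := Choice.on (word g).

Fact word_unit (g : nat) (v w : word g) : v ++ w = [::] -> v = [::] /\ w = [::].
Proof. by case: v. Qed.

HB.instance Definition _ (g : nat) :=
  Choice_isMonomialDef.Build (word g)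
    (@catA 'I_g) (@cat0s 'I_g) (@cats0 'I_g) (@word_unit g).

Notation freepoly R g := {malg R[word g]}.

Section MatrixPoly.
Variables (R : realType) (g d d' : nat).
Implicit Type p : 'M[freepoly R g]_(d, d').

Definition mxcoef p (w : word g) : 'M[R]_(d, d') := map_mx (mcoeff w) p.

Definition mxsupp p : {fset word g} :=
  \big[fsetU/fset0]_(ij : 'I_d * 'I_d') msupp (p ij.1 ij.2).

Lemma mem_mxsupp p w : (w \in mxsupp p) = (mxcoef p w != 0).
Proof.
have -> : (w \in mxsupp p) = [exists ij, mxcoef p w ij.1 ij.2 != 0].
  apply/bigfcupP/existsP => [[[i j] _ /=]|[[i j] /= h]].
    by rewrite -mcoeff_neq0 => nz; exists (i, j); rewrite mxE.
  exists (i, j); first by rewrite mem_index_enum.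
  by rewrite -mcoeff_neq0; move: h; rewrite mxE.
apply/existsP/idP => [[ij]|]; first by apply: contra => /eqP ->; rewrite mxE.
move=> nz; apply/existsP; apply: contraNT nz; rewrite negb_exists => /forallP z.
by apply/eqP/matrixP => i j; move: (z (i, j)); rewrite negbK mxE => /eqP /= ->; rewrite mxE.
Qed.

Definition word_eval n (X : 'I_g -> 'M[R]_n) (w : word g) : 'M[R]_n :=
  \big[mulmx/1%:M]_(j <- w) X j.

Definition peval n p (X : 'I_g -> 'M[R]_n) : 'M[R]_(d * n, d' * n) :=
  \sum_(w <- mxsupp p) tensmx (mxcoef p w) (word_eval X w).

(* The sum in [peval] may be taken over any finite set of words containing
   the support. *)
Lemma pevalEw n p (X : 'I_g -> 'M[R]_n) (D : {fset word g}) :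
  (forall w, mxcoef p w != 0 -> w \in D) ->
  peval p X = \sum_(w <- D) tensmx (mxcoef p w) (word_eval X w).
Proof.
move=> sD; rewrite /peval; apply/esym.
rewrite (bigID (mem (mxsupp p))) /= [X in _ + X]big1 ?addr0; last first.
  by move=> w; rewrite mem_mxsupp negbK => /eqP ->; rewrite tens0mx.
rewrite -big_filter; apply: perm_big; apply: uniq_perm.
- by rewrite filter_uniq // fset_uniq.
- exact: fset_uniq.
- move=> w; rewrite mem_filter; case: (boolP (w \in mxsupp p)) => //=.
  by rewrite mem_mxsupp => /sD ->.
Qed.

End MatrixPoly.

Definition freepoly_rev (R : realType) (g : nat) (q : freepoly R g) :
  freepoly R g := \sum_(w <- msupp q) << q@_w *g (rev w : word g) >>.

Definition ptrans (R : realType) (g d d' : nat) (p : 'M[freepoly R g]_(d, d')) :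
  'M[freepoly R g]_(d', d) := map_mx (@freepoly_rev R g) p^T.

Lemma mxcoef_ptrans (R : realType) (g d d' : nat)
    (p : 'M[freepoly R g]_(d, d')) (w : word g) :
  mxcoef (ptrans p) w = (mxcoef p (rev w : word g))^T.
Proof.
apply/matrixP => i j; rewrite !mxE /freepoly_rev raddf_sum /=.
case: (msuppP (p j i) (rev w : word g)) => h.
  rewrite (big_fsetD1 (rev w : word g)) //= mcoeffU revK eqxx big1_fset ?addr0 //.
  move=> v; rewrite in_fsetD1 mcoeffU => /andP[vw _] _.
  by case: eqP => // E; move: vw; rewrite -E revK eqxx.
rewrite big1_fset // => v hv _; rewrite mcoeffU; case: eqP => // E.
by move: h; rewrite -E revK hv.
Qed.

Definition psymmetric (R : realType) (g d : nat) (p : 'M[freepoly R g]_d) : Prop :=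
  ptrans p = p.

Definition symtuple (R : realType) (g n : nat) : set ('I_g -> 'M[R]_n) :=
  [set X | forall j, (X j)^T = X j].

(* Only the components S n with 0 < n are meaningful: the predicates below
   ignore S 0. *)
Definition gradedset (R : realType) (g : nat) : Type :=
  forall n : nat, set ('I_g -> 'M[R]_n).

Definition gradedset_eq (R : realType) (g : nat) (S T : gradedset R g) : Prop :=
  forall n, (0 < n)%N -> S n = T n.

Definition gradedset_convex (R : realType) (g : nat) (S : gradedset R g) : Prop :=
  forall n, (0 < n)%N ->
    convex_set (S n : set (convex_lmodType ('I_g -> 'M[R]_n))).

Definition enorm (R : realType) (n : nat) (v : 'cV[R]_n) : R :=
  Num.sqrt (\sum_i v i 0 ^+ 2).

(* The Euclidean operator norm; the norm `|A| of the library on matrices is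
   the largest absolute value of an entry, which is not equivalent to it
   uniformly in n. *)
Definition opnorm (R : realType) (n : nat) (A : 'M[R]_n) : R :=
  sup [set enorm (A *m v) | v in [set v : 'cV[R]_n | enorm v <= 1]].

Definition gradedset_bounded (R : realType) (g : nat) (S : gradedset R g) : Prop :=
  exists K : R, forall n, (0 < n)%N ->
    forall X : 'I_g -> 'M[R]_n, S n X -> \sum_j opnorm (X j) <= K.

Definition invset (R : realType) (g d : nat) (p : 'M[freepoly R g]_d) :
    gradedset R g := fun n =>
  @connected_component {ptws 'I_g -> 'M[R]_n}
    [set X : 'I_g -> 'M[R]_n | symtuple X /\ peval p X \in unitmx]
    (fun=> 0).

Definition pencil (R : realType) (g l : nat) (A : 'I_g -> 'M[R]_l) :
    'M[freepoly R g]_l :=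
  1%:M + \sum_j map_mx (fun a : R => << a *g ([:: j] : word g) >>) (A j).

Definition posdefmx (R : realType) (m : nat) (M : 'M[R]_m) : Prop :=
  M^T = M /\ forall v : 'cV[R]_m, v != 0 -> 0 < (v^T *m M *m v) 0 0.

Definition pencilset (R : realType) (g l : nat) (A : 'I_g -> 'M[R]_l) :
    gradedset R g := fun n =>
  [set X | symtuple X /\ posdefmx (peval (pencil A) X)].

Definition has_LMI (R : realType) (g : nat) (C : gradedset R g) : Prop :=
  exists (l : nat) (A : 'I_g -> 'M[R]_l),
    [/\ (0 < l)%N, symtuple A & gradedset_eq C (pencilset A)].

Lemma peval_pencil (R : realType) (g l n : nat) (A : 'I_g -> 'M[R]_l)
    (X : 'I_g -> 'M[R]_n) :
  peval (pencil A) X = 1%:M + \sum_j tensmx (A j) (X j).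
Proof.
have coefE w : mxcoef (pencil A) w = (w == [::])%:R%:M
    + \sum_j (w == [:: j])%:R *: A j.
  apply/matrixP => i k; rewrite !mxE raddfD /= !summxE raddf_sum /=.
  congr (_ + _).
    case: (i == k); last by rewrite mulr0n mcoeff0 mulr0n.
    by rewrite mulr1n mulr1n mcoeff1.
  apply: eq_bigr => j _; rewrite !mxE mcoeffU eq_sym.
  by case: (w == _); rewrite ?mul1r ?mul0r.
pose D : seq (word g) := [::] :: [seq [:: j] | j <- index_enum 'I_g].
have uD : uniq D.
  rewrite /= map_inj_uniq ?index_enum_uniq ?andbT; last by move=> ? ? [].
  by apply/mapP => -[].
rewrite (@pevalEw _ _ _ _ _ _ _ [fset w in D]%fset); last first.
  move=> w; rewrite in_fset /= coefE; apply: contraNT => nD.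
  apply/eqP; move: nD; rewrite inE negb_or => /andP[/negbTE -> nD].
  rewrite raddf0 add0r big1 // => j _; case: eqP => [E|]; last by rewrite scale0r.
  by case/mapP: nD; exists j; rewrite ?mem_index_enum.
rewrite (perm_big D) /=; last first.
  apply: uniq_perm; rewrite ?fset_uniq //.
  by move=> w; rewrite in_fset.
rewrite big_cons big_map; congr (_ + _).
  rewrite coefE eqxx big1 ?addr0; last by move=> j _; rewrite scale0r.
  rewrite /word_eval big_nil; apply/matrixP => a b.
  case: (mxtens_indexP a) (mxtens_indexP b) => i j [k m].
  rewrite tensmxE !mxE (can_eq (@mxtens_indexK _ _)) xpair_eqE.
  by do 2!case: eqP => _; rewrite ?mulr0 ?mul0r ?mulr1.
apply: eq_bigr => j _; rewrite coefE /= raddf0 add0r /word_eval big_cons big_nil mulmx1.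
congr tensmx; rewrite (bigD1 j) //= eqxx scale1r big1 ?addr0 // => k kj.
by rewrite eqseq_cons andbT eq_sym (negbTE kj) scale0r.
Qed.

(* Main.v *)
Require Import Defs.
From mathcomp Require Import all_boot all_order all_algebra finmap.
From mathcomp Require Import monalg mxtens.
From mathcomp Require Import boolp classical_sets functions reals.
From mathcomp Require Import interval_inference topology normedtype convex.
From mathcomp Require Import ring lra.

(* A convex invertibility set is star-shaped, so it consists of the symmetric
   [X] for which [p(tX)] is invertible on all of [0, 1]; hence it is closed under
   block sums, orthogonal conjugation and, averaging with a reflection, under
   [X |-> P X P] for projections [P].

   Let [X] be a boundary point and [p(X) N = 0] with [N <> 0]. Let the columns of
   [Q] be a basis of the span of the columns of [w(X) N] with [|w| <= k], where
   [deg p <= k + 1]. The Gram data [(Q^T X Q, Q^T Q)] is not of the form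
   [(V^T Y V, V^T V)] with [Y] in the set, for otherwise [N] would be transported
   to a kernel vector of [p] at a compression of [Y]. Separating this point from
   the convex cone of all such Gram data gives a monic pencil that is positive
   semidefinite on the set and has, at [X], a kernel vector built from the
   columns of [Q].

   Being singular at [X] is then a condition [r(X) N = 0] on polynomials [r] of
   degree at most [k + 1]. If [(X, N)] is chosen so that few polynomials of that
   degree kill it, the condition persists at every boundary point, and the
   pencil is singular there unless the transported kernel vector vanishes. An
   induction on dimension handles these exceptions; the direct sum of the
   finitely many pencils obtained is positive definite exactly on the set. *)

Set Implicit Arguments.
Unset Strict Implicit.
Unset Printing Implicit Defensive.

Import Order.TTheory GRing.Theory Num.Theory.

Local Open Scope ring_scope.

(** * Positive semidefinite matrices and convex cones *)

Section PSD.
Variable R : rcfType.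

Definition psdmx n (M : 'M[R]_n) : Prop :=
  M^T = M /\ forall v : 'cV[R]_n, 0 <= (v^T *m M *m v) 0 0.

Lemma mxtrace_gram_ge0 m n (V : 'M[R]_(m, n)) : 0 <= \tr (V^T *m V).
Proof.
rewrite /mxtrace sumr_ge0 // => i _; rewrite mxE sumr_ge0 // => k _.
by rewrite mxE -expr2 sqr_ge0.
Qed.

Lemma mxtrace_gram_eq0 m n (V : 'M[R]_(m, n)) : \tr (V^T *m V) = 0 -> V = 0.
Proof.
move=> /eqP; rewrite psumr_eq0 => [/allP V0|i _]; last first.
  by rewrite mxE sumr_ge0 // => k _; rewrite mxE -expr2 sqr_ge0.
apply/matrixP => i j; have := V0 j (mem_index_enum _); rewrite mxE psumr_eq0; last first.
  by move=> k _; rewrite mxE -expr2 sqr_ge0.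
by move/allP/(_ i (mem_index_enum _)); rewrite !mxE -expr2 sqrf_eq0 => /eqP.
Qed.

Lemma mxtrace_gram_gt0 m n (V : 'M[R]_(m, n)) : V != 0 -> 0 < \tr (V^T *m V).
Proof.
move=> V0; rewrite lt_neqAle mxtrace_gram_ge0 andbT eq_sym.
by apply: contraNneq V0 => /mxtrace_gram_eq0 ->.
Qed.

Lemma gram_eq0 m n k (V : 'M[R]_(m, n)) (c : 'M[R]_(n, k)) :
  V^T *m V *m c = 0 -> V *m c = 0.
Proof.
move=> h; apply: mxtrace_gram_eq0.
by rewrite trmx_mul mulmxA -(mulmxA _ V^T) -mulmxA h mulmx0 mxtrace0.
Qed.

(** First-order optimality without division by [c]: at [s = - b / (1 + c)] the expression equals
    [- (b / (1 + c)) ^+ 2], which also covers [c = 0]. *)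
Lemma quad_ge0_lin0 (b c : R) : (forall s, 0 <= s * b + s ^+ 2 * c) -> b = 0.
Proof.
move=> h.
have c0 : 0 <= c by have := h 1; have := h (-1); nra.
have := h (- b / (1 + c)) => hb.
apply/eqP; apply: contraT => bn0; exfalso; move: hb; apply/negP; rewrite -ltNge.
have c1 : 1 + c != 0 by rewrite gt_eqF //; lra.
have -> : - b / (1 + c) * b + (- b / (1 + c)) ^+ 2 * c = - (b / (1 + c)) ^+ 2.
  by field.
by rewrite oppr_lt0 exprn_even_gt0 //= mulf_neq0 ?invr_eq0.
Qed.

(* One step of symmetric Gaussian elimination; a vanishing pivot forces its
   whole row to vanish. *)
Lemma psdmx_factor n (T : 'M[R]_n) : psdmx T ->
  exists l (S : 'M[R]_(l, n)) (U : 'M[R]_(n, l)), T = S^T *m S /\ S *m U = 1%:M.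
Proof.
elim: n T => [|n IH] T [sT pT].
  exists 0%N, 0, 0; split; last by apply/matrixP => -[].
  by apply/matrixP => -[].
rewrite -[n.+1]/(1 + n)%N in T sT pT *.
rewrite -[T]submxK in sT pT *.
set a := ulsubmx T in sT pT *; set b := ursubmx T in sT pT *.
set c := dlsubmx T in sT pT *; set M := drsubmx T in sT pT *.
move: sT; rewrite tr_block_mx => /eq_block_mx [_ _ cE MT].
rewrite -cE in pT *; move: pT; clearbody a b M; clear c cE => pT.
have form (x : 'cV[R]_1) (y : 'cV[R]_n) :
    0 <= (x^T *m a *m x + x^T *m b *m y + y^T *m b^T *m x + y^T *m M *m y) 0 0.
  have := pT (col_mx x y).
  rewrite tr_col_mx mul_row_block mul_row_col !mulmxDl !addrA.
  by rewrite -!addrA [X in _ + X]addrCA.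
have {}form (x : R) (y : 'cV[R]_n) :
    0 <= x ^+ 2 * a 0 0 + x * (b *m y) 0 0 *+ 2 + (y^T *m M *m y) 0 0.
  have := form x%:M y; rewrite tr_scalar_mx !mul_scalar_mx !mul_mx_scalar -scalemxAl -trmx_mul.
  by rewrite !mxE expr2 mulr2n -mulrA !addrA.
have a0 : 0 <= a 0 0.
  by have := form 1 0; rewrite !mulmx0 !mxE expr1n mulr0 mul0rn !addr0 mul1r.
case: (eqVneq (a 0 0) 0) => [az|an0].
  have bz : b = 0.
    apply/matrixP => i j; rewrite ord1 [RHS]mxE.
    pose y : 'cV[R]_n := delta_mx j 0.
    have : (b *m y) 0 0 *+ 2 = 0.
      apply: (@quad_ge0_lin0 _ ((y^T *m M *m y) 0 0)) => s.
      have := form 1 (s *: y); rewrite az mulr0 add0r mul1r.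
      rewrite [(s *: y)^T]linearZ /= -!(scalemxAr, scalemxAl) scalerA.
      by rewrite [(s *: (b *m y)) _ _]mxE [(_ *: (_ *m _)) _ _]mxE expr2 mulrnAr.
    by move/eqP; rewrite mulrn_eq0 /= -colE mxE => /eqP.
  have [] := IH M.
    by split => // y; have := form 0 y; rewrite expr0n /= !mul0r mul0rn !add0r.
  move=> l [S [U [MS SU]]].
  exists l, (row_mx 0 S), (col_mx 0 U); split; last by rewrite mul_row_col mul0mx add0r.
  rewrite tr_row_mx mul_col_row -MS bz !trmx0 !mulmx0 mul0mx.
  by congr block_mx; apply/matrixP => i j; rewrite !ord1 az mxE.
pose r := Num.sqrt (a 0 0).
have r2 : r ^+ 2 = a 0 0 by rewrite sqr_sqrtr.
have rn0 : r != 0 by rewrite sqrtr_eq0 -ltNge lt_neqAle eq_sym an0.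
(* Recursion on the Schur complement: its form at [y] is the form of [T] with first coordinate
   [- (b *m y) / a]. *)
have [] := IH (M - (a 0 0)^-1 *: (b^T *m b)).
  split.
    by rewrite linearB /= linearZ /= trmx_mul trmxK MT.
  move=> y; have := form (- (a 0 0)^-1 * (b *m y) 0 0) y.
  rewrite mulmxBr mulmxBl [X in _ -> 0 <= X]mxE [X in _ -> 0 <= _ + X]mxE.
  rewrite -scalemxAr -scalemxAl [X in _ -> 0 <= _ - X]mxE.
  rewrite [(y^T *m (b^T *m b) *m y) 0 0](_ : _ = (b *m y) 0 0 ^+ 2); last first.
    by rewrite mulmxA -mulmxA -trmx_mul mxE big_ord1 [_^T _ _]mxE expr2.
  set u := (b *m y) 0 0; set v := (y^T *m M *m y) 0 0; set z := a 0 0.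
  suff -> : (- z^-1 * u) ^+ 2 * z + - z^-1 * u * u *+ 2 + v = v - z^-1 * u ^+ 2 by [].
  by field.
move=> l [S [U [MS SU]]].
exists (1 + l)%N, (block_mx r%:M (r^-1 *: b) 0 S),
  (block_mx r^-1%:M (- (r ^- 2) *: (b *m U)) 0 U); split.
  rewrite tr_block_mx mulmx_block !trmx0 !mul0mx !mulmx0 !addr0 tr_scalar_mx.
  rewrite -scalar_mxM -expr2 r2 !mul_scalar_mx !scalerA divff // scale1r.
  rewrite linearZ /= mul_mx_scalar scalerA divff // scale1r -MS.
  rewrite -scalemxAl -scalemxAr scalerA -invfM -expr2 r2.
  rewrite addrC subrK; congr block_mx.
  by apply/matrixP => i j; rewrite !ord1 mxE mulr1n.
rewrite mulmx_block !mulmx0 !mul0mx !addr0 !add0r SU -scalar_mxM divff //.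
rewrite mul_scalar_mx scalerA -scalemxAl -scalerDl.
rewrite (_ : r * - r ^- 2 + r^-1 = 0); last by field.
by rewrite scale0r -scalar_mx_block.
Qed.

Lemma psdmx_gram m n (V : 'M[R]_(m, n)) (c : 'cV[R]_n) :
  (c^T *m (V^T *m V) *m c) 0 0 = \tr ((V *m c)^T *m (V *m c)).
Proof. by rewrite trmx_mul !mulmxA /mxtrace big_ord1. Qed.

Lemma psdmx_ker n (M : 'M[R]_n) (u : 'cV[R]_n) :
  psdmx M -> (u^T *m M *m u) 0 0 = 0 -> M *m u = 0.
Proof.
move=> /psdmx_factor [l [S [U [-> _]]]]; rewrite psdmx_gram => /mxtrace_gram_eq0.
by rewrite -mulmxA => ->; rewrite mulmx0.
Qed.

(** The shift exceeds the sum of all [|H i j|], and [|v_i v_j|] is at most the squared length of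
    [v], so the shifted form is nonnegative. *)
Lemma sym_shift_gram n (H : 'M[R]_n) : H^T = H ->
  exists t l (S : 'M[R]_(l, n)), 0 < t /\ t%:M + H = S^T *m S.
Proof.
move=> sH; pose t := 1 + \sum_i \sum_j `|H i j|.
have t0 : 0 < t.
  by rewrite ltr_pwDl // sumr_ge0 // => i _; rewrite sumr_ge0.
have [|l [S [U [E _]]]] := @psdmx_factor n (t%:M + H).
- split=> [|v]; first by rewrite linearD /= tr_scalar_mx sH.
  rewrite mulmxDr mulmxDl mul_mx_scalar -scalemxAl mxE [X in X + _]mxE.
  set q := (v^T *m v) 0 0.
  have qE : q = \sum_i v i 0 ^+ 2.
    by rewrite /q mxE; apply: eq_bigr => i _; rewrite mxE expr2.
  have q0 : 0 <= q by rewrite qE sumr_ge0 // => i _; rewrite sqr_ge0.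
  have vq i : v i 0 ^+ 2 <= q.
    rewrite qE (bigD1 i) //= lerDl sumr_ge0 // => k _; exact: sqr_ge0.
  have : - (v^T *m H *m v) 0 0 <= (\sum_i \sum_j `|H i j|) * q.
    rewrite exchange_big mulr_suml mxE -sumrN ler_sum // => j _.
    rewrite mxE !mulr_suml -sumrN ler_sum // => i _.
    rewrite [_^T _ _]mxE (le_trans (ler_norm _)) // normrN !normrM mulrAC mulrC ler_wpM2l //.
    have := vq i; have := vq j.
    rewrite -(real_normK (num_real (v i 0))) -(real_normK (num_real (v j 0))).
    move: (normr_ge0 (v i 0)) (normr_ge0 (v j 0)); nra.
  by rewrite /t mulrDl mul1r; lra.
by exists t, l, S.
Qed.

End PSD.

(** * Algebraic separation for cones with an order unit *)

Section ConeSeparation.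
Variables (R : realType) (I : finType).
Implicit Types (K : {ffun I -> R^o} -> Prop) (e x : {ffun I -> R^o}).

Definition cone_closed K : Prop :=
  (forall u v, K u -> K v -> K (u + v)) /\
  (forall s u, 0 <= s -> K u -> K (s *: u)).

Definition order_unit K e : Prop :=
  K e /\ forall w, exists t : R, K (t *: e + w).

Lemma cone_unit_ge0 K e t : cone_closed K -> ~ K (- e) -> K (t *: e) -> 0 <= t.
Proof.
move=> [_ Kz] Ke Kt; rewrite leNgt; apply/negP => t0; apply: Ke.
have := Kz (- t^-1) _ _ Kt; rewrite scalerA mulNr mulVf ?lt_eqF // scaleN1r.
by apply; rewrite oppr_ge0 invr_le0 ltW.
Qed.


(** The value [c], the infimum of the [t] with [t *: e - b] in [K], is the one a state may give to
    [b]. If the line through [b - c *: e] brought in [- e], a positive [s] would contradict that [c]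
    is the greatest lower bound, a negative [s] that it is a lower bound. *)
Lemma cone_extend K e b : cone_closed K -> order_unit K e -> ~ K (- e) ->
  exists c : R, ~ exists s, K (- e + s *: (b - c *: e)).
Proof.
move=> cK [_ uK] Ke; have [Kd Kz] := cK.
pose A := [set t : R | K (t *: e - b)]%classic; pose c := inf A.
have infA : has_inf A.
  split; first by have [t] := uK (- b); exists t.
  have [t Kt] := uK b; exists (- t) => s /= Ks.
  have := Kd _ _ Kt Ks; rewrite addrACA subrr addr0 -scalerDl.
  by move=> /(cone_unit_ge0 cK Ke); rewrite -lerBlDl sub0r.
exists c => -[s Ks]; case: (ltrgt0P s) => s0.
- have := Kz s^-1 _ _ Ks; rewrite invr_ge0 (ltW s0) => /(_ isT).
  rewrite scalerDr scalerA mulVf ?gt_eqF // scale1r => {}Ks.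
  have si0 : 0 < s^-1 by rewrite invr_gt0.
  have [t At tc] := inf_adherent si0 infA.
  have := Kd _ _ Ks At.
  have -> : s^-1 *: - e + (b - c *: e) + (t *: e - b) = (t - (c + s^-1)) *: e.
    by apply/ffunP => i; rewrite !ffunE /GRing.scale /=; ring.
  by move=> /(cone_unit_ge0 cK Ke); rewrite subr_ge0 leNgt tc.
- have := Kz (- s^-1) _ _ Ks; rewrite oppr_ge0 invr_le0 (ltW s0) => /(_ isT).
  rewrite scalerDr scalerA mulNr mulVf ?lt_eqF // => {}Ks.
  have : A (c + s^-1).
    rewrite /A /=; congr K : Ks; apply/ffunP => i; rewrite !ffunE /GRing.scale /=; ring.
  by move=> /(ge_inf (proj2 infA)); rewrite -/c lerDl invr_ge0 leNgt s0.
- by move: Ks; rewrite s0 scale0r addr0.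
Qed.

(* Each coordinate direction is successively absorbed into the lineality
   space, modulo a multiple of the order unit. *)
Lemma cone_state K e : cone_closed K -> order_unit K e -> ~ K (- e) ->
  exists c : I -> R, (forall w, K w -> 0 <= \sum_i c i * w i) /\
                     \sum_i c i * e i = 1.
Proof.
move=> cK [Kee uK] Ke.
pose b (i : I) : {ffun I -> R^o} := [ffun j => (i == j)%:R].
have [c [K' [cK' KK' Ke' Kb]]] : exists (c : I -> R) K',
    [/\ cone_closed K', forall w, K w -> K' w, ~ K' (- e) &
        forall i s, i \in enum I -> K' (s *: (b i - c i *: e))].
  elim: (enum I) => [|i s [c [K' [cK' KK' Ke' Kb]]]].
    by exists (fun=> 0), K.
  have uK' : order_unit K' e.
    by split=> [|w]; [exact: KK' | have [t /KK'] := uK w; exists t].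
  have [t Kt] := cone_extend (b i) cK' uK' Ke'.
  have [Kd Kz] := cK'.
  exists (fun j => if j == i then t else c j).
  exists (fun w => exists s, K' (w + s *: (b i - t *: e))).
  have sub w : K' w -> exists s0, K' (w + s0 *: (b i - t *: e)).
    by move=> Kw; exists 0; rewrite scale0r addr0.
  split=> //.
  - split=> [u v [s1 K1] [s2 K2]|r u r0 [s1 K1]].
      by exists (s1 + s2); rewrite scalerDl addrACA; apply: Kd.
    by exists (r * s1); rewrite -scalerA -scalerDr; apply: Kz.
  - by move=> w /KK' /sub.
  - move=> j s0; rewrite inE; case: eqP => [-> _|_ /= /Kb]; last by move=> /(_ s0) /sub.
    exists (- s0); rewrite scaleNr subrr -[0](scale0r e).
    by apply: Kz => //; apply: KK'.
have [Kd Kz] := cK'.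
pose phi (w : {ffun I -> R^o}) := \sum_i c i * w i.
(* Modulo the lineality space of [K'], each [w] equals [phi w *: e]; so the sign of [phi] on [K] is
   read off on multiples of [e]. *)
have lin (w : {ffun I -> R^o}) a : K' (a *: (w - phi w *: e)).
  have -> : a *: (w - phi w *: e) = \sum_i (a * w i) *: (b i - c i *: e).
    apply/ffunP => j; rewrite sum_ffunE !ffunE /phi.
    rewrite [RHS](eq_bigr (fun i => a * (w i * (i == j)%:R) - a * (c i * w i) * e j)).
      rewrite sumrB -mulr_suml -!mulr_sumr [\sum_(i | _) w i * _](bigD1 j) //= eqxx.
      rewrite [\sum_(i | i != j) _]big1 => [|i ij].
        by rewrite /GRing.scale /=; ring.
      by rewrite (negbTE ij) mulr0.
    by move=> i _; rewrite !ffunE /GRing.scale /=; ring.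
  elim/big_ind: _ => //.
    by have := Kz 0 _ _ (KK' _ Kee); rewrite scale0r; apply.
  by move=> i _; apply: Kb; rewrite mem_enum.
exists c; split=> [w Kw|].
  apply: (cone_unit_ge0 cK' Ke').
  by have := Kd _ _ (KK' _ Kw) (lin w (-1)); rewrite scaleN1r opprB addrC subrK.
have E a : K' ((a * (1 - phi e)) *: e).
  by have := lin e a; rewrite -[X in X - _]scale1r -scalerBl scalerA.
apply/eqP; rewrite eq_sym -subr_eq0 eq_le; apply/andP; split.
  by have := E (-1); rewrite mulN1r => /(cone_unit_ge0 cK' Ke'); rewrite oppr_ge0.
by have := E 1; rewrite mul1r => /(cone_unit_ge0 cK' Ke').
Qed.

(** A state of the cone [K1] generated by [K] and [- x] does it. If [- e] were in [K1], then some
    [a *: x - e] would lie in [K], and adding multiples of [e] would put [x] in [K]. *)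
Lemma cone_separation K e x : cone_closed K -> order_unit K e -> ~ K x ->
  exists c : I -> R, [/\ forall w, K w -> 0 <= \sum_i c i * w i,
    \sum_i c i * e i = 1 & \sum_i c i * x i <= 0].
Proof.
move=> cK [Kee uK] Kx; have [Kd Kz] := cK.
pose K1 w := exists2 a, 0 <= a & K (w + a *: x).
have sub w : K w -> K1 w by move=> Kw; exists 0 => //; rewrite scale0r addr0.
have K0 : K 0 by have := Kz 0 _ _ Kee; rewrite scale0r; apply.
have [||[a a0 Ka]|c [Kc ce]] := @cone_state K1 e.
- split=> [u v [s1 s10 K1u] [s2 s20 K2]|r u r0 [s1 s10 K1u]].
    by exists (s1 + s2); rewrite ?addr_ge0 // scalerDl addrACA; apply: Kd.
  by exists (r * s1); rewrite ?mulr_ge0 // -scalerA -scalerDr; apply: Kz.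
- by split=> [|w]; [exact: sub | have [t /sub] := uK w; exists t].
- apply: Kx; case: (eqVneq a 0) => [a0'|an0].
    move: Ka; rewrite a0' scale0r addr0 => Ka; have [t Kt] := uK x.
    case: (lerP 0 t) => t0.
      by have := Kd _ _ Kt (Kz _ _ t0 Ka); rewrite addrAC scalerN subrr add0r.
    have := Kd _ _ Kt (Kz (- t) _ _ Kee); rewrite oppr_ge0 addrAC scaleNr subrr add0r.
    by apply; exact: ltW.
  have := Kz a^-1 _ _ (Kd _ _ Ka Kee); rewrite addrAC addNr add0r scalerA mulVf // scale1r.
  by apply; rewrite invr_ge0.
exists c; split=> // [w /sub|]; first exact: Kc.
rewrite -oppr_ge0 -sumrN (eq_bigr (fun i => c i * (- x) i)) => [|i _].
  by apply: Kc; exists 1 => //; rewrite scale1r addNr.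
by rewrite ffunE mulrN.
Qed.

End ConeSeparation.

(** * Separation of Gram data *)

Section Separation.
Variables (R : realType) (g : nat).

(* [<(I - sum_j A_j (x) Y_j) vec V, vec V>], with vectors of [R^l (x) R^m]
   written as [m x l] matrices. *)
Definition pform l m (A : 'I_g -> 'M[R]_l) (Y : 'I_g -> 'M[R]_m)
    (V : 'M[R]_(m, l)) : R :=
  \tr (V^T *m V) - \sum_j \tr (A j *m (V^T *m Y j *m V)).

Definition pencil_act l m (A : 'I_g -> 'M[R]_l) (Y : 'I_g -> 'M[R]_m)
    (V : 'M[R]_(m, l)) : 'M[R]_(m, l) := V - \sum_j Y j *m V *m A j.

Lemma pformE l m (A : 'I_g -> 'M[R]_l) (Y : 'I_g -> 'M[R]_m) V :
  pform A Y V = \tr (V^T *m pencil_act A Y V).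
Proof.
rewrite /pform /pencil_act mulmxBr mulmx_sumr linearB /= linear_sum /=.
by congr (_ - _); apply: eq_bigr => j _; rewrite mxtrace_mulC !mulmxA.
Qed.

(** A vector at which a nonnegative form is nonpositive lies in the kernel of the form: perturb [V]
    in the direction of its own image [W]. *)
Lemma pform_critical l m (A : 'I_g -> 'M[R]_l) (Y : 'I_g -> 'M[R]_m) V :
  (forall j, (A j)^T = A j) -> (forall j, (Y j)^T = Y j) ->
  (forall W, 0 <= pform A Y W) -> pform A Y V <= 0 ->
  V = \sum_j Y j *m V *m A j.
Proof.
move=> sA sY pos V0.
have LD s (P Q : 'M[R]_(m, l)) :
    pencil_act A Y (P + s *: Q) = pencil_act A Y P + s *: pencil_act A Y Q.
  rewrite /pencil_act scalerBr scaler_sumr addrACA -opprD -big_split /=.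
  congr (_ - _); apply: eq_bigr => j _.
  by rewrite mulmxDr mulmxDl -scalemxAr -scalemxAl.
have LC (P Q : 'M[R]_(m, l)) :
    \tr (P^T *m pencil_act A Y Q) = \tr (Q^T *m pencil_act A Y P).
  have LE (P' Q' : 'M[R]_(m, l)) : \tr (P'^T *m pencil_act A Y Q') =
      \tr (P'^T *m Q') - \sum_j \tr (P'^T *m (Y j *m Q' *m A j)).
    by rewrite /pencil_act mulmxBr mulmx_sumr linearB /= linear_sum.
  rewrite !LE -(mxtrace_tr (P^T *m Q)) trmx_mul trmxK.
  congr (_ - _); apply: eq_bigr => j _.
  by rewrite -mxtrace_tr !trmx_mul sA sY trmxK -!mulmxA mxtrace_mulC !mulmxA.
set W := pencil_act A Y V.
suff : \tr (W^T *m W) = 0.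
  by move/mxtrace_gram_eq0/eqP; rewrite subr_eq0 => /eqP.
apply: (@quad_ge0_lin0 _ _ (pform A Y W)) => s.
(* With the half, the two cross terms add up to [s * \tr (W^T *m W)]. *)
have := pos (V + (2^-1 * s) *: W).
have := pos W.
rewrite !pformE in V0 *.
rewrite LD -/W; rewrite -/W in V0; move: (LC V W); rewrite -/W.
move: W (pencil_act A Y W) V0 => W Z V0 VW.
rewrite [(_ + _)^T]linearD /= [((_ * s) *: _)^T]linearZ /=.
rewrite mulmxDr !mulmxDl -!(scalemxAr, scalemxAl).
rewrite !mxtraceD !mxtraceZ VW.
move: (\tr (V^T *m W)) (\tr (W^T *m W)) (\tr (W^T *m Z)) V0 => a b c.
nra.
Qed.

Variable D : forall m, ('I_g -> 'M[R]_m) -> Prop.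
Hypothesis Dsym : forall m (Y : 'I_g -> 'M[R]_m), D Y -> forall j, (Y j)^T = Y j.
Hypothesis Dsum : forall m1 m2 (Y1 : 'I_g -> 'M[R]_m1) (Y2 : 'I_g -> 'M[R]_m2),
  D Y1 -> D Y2 -> D (fun j => block_mx (Y1 j) 0 0 (Y2 j)).
Hypothesis Dcore : forall m (Y : 'I_g -> 'M[R]_m), (forall j, (Y j)^T = Y j) ->
  exists2 eps, 0 < eps & D (fun j => eps *: Y j).

Let D0 m : D (fun=> 0 : 'M[R]_m).
Proof.
have [|e _] := @Dcore m (fun=> 0); first by move=> j; rewrite trmx0.
by congr D; apply/funext => j; rewrite scaler0.
Qed.

(** Gram data of all sizes [m] form a convex cone: stacking the [V] over block sums adds data, and
    scaling [V] by a square root scales them. The zero tuple with [Q] gives an order unit. *)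
Lemma gram_cone_separation r n (X : 'I_g -> 'M[R]_n) (Q : 'M[R]_(n, r)) :
  Q^T *m Q \in unitmx -> (forall j, (X j)^T = X j) ->
  (forall m (Y : 'I_g -> 'M[R]_m) V, D Y -> V^T *m V = Q^T *m Q ->
     ~ (forall j, V^T *m Y j *m V = Q^T *m X j *m Q)) ->
  exists (T : 'M[R]_r) (B : 'I_g -> 'M[R]_r),
    [/\ T^T = T /\ (forall j, (B j)^T = B j),
        forall m (Y : 'I_g -> 'M[R]_m) V, D Y ->
          \sum_j \tr (B j *m (V^T *m Y j *m V)) <= \tr (T *m (V^T *m V)),
        \tr (T *m (Q^T *m Q)) = 1 &
        1 <= \sum_j \tr (B j *m (Q^T *m X j *m Q))].
Proof.
move=> uG sX nX; set G := Q^T *m Q in uG *.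
have sG : G^T = G by rewrite trmx_mul trmxK.
pose I := (option 'I_g * ('I_r * 'I_r))%type.
(* Arbitrary coordinate functions code symmetric matrices through [sm], which adds the transpose;
   [pt] is a section of it, hence its [2^-1]. *)
pose mat (f : {ffun I -> R^o}) o : 'M[R]_r := \matrix_(a, b) f (o, (a, b)).
pose sm f o := mat f o + (mat f o)^T.
pose pt (F : option 'I_g -> 'M[R]_r) : {ffun I -> R^o} :=
  [ffun i => 2^-1 * F i.1 i.2.1 i.2.2].
have smpt F o : (F o)^T = F o -> sm (pt F) o = F o.
  move=> /matrixP sF; apply/matrixP => a b; have := sF a b.
  by rewrite !mxE !ffunE /=; lra.
have smD u v o : sm (u + v) o = sm u o + sm v o.
  by apply/matrixP => a b; rewrite !mxE !ffunE addrACA.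
have smZ s u o : sm (s *: u) o = s *: sm u o.
  by apply/matrixP => a b; rewrite !mxE !ffunE mulrDr.
pose K f := exists m (Y : 'I_g -> 'M[R]_m) V, [/\ D Y, sm f None = V^T *m V &
  forall j, sm f (Some j) = V^T *m Y j *m V].
pose ptV m (Y : 'I_g -> 'M[R]_m) V :=
  pt (fun o => if o is Some j then V^T *m Y j *m V else V^T *m V).
have smptV m (Y : 'I_g -> 'M[R]_m) V (sY : forall j, (Y j)^T = Y j) :
    sm (ptV m Y V) None = V^T *m V /\ forall j, sm (ptV m Y V) (Some j) = V^T *m Y j *m V.
  by split=> [|j]; rewrite smpt // !trmx_mul !trmxK // sY mulmxA.
have KptV m (Y : 'I_g -> 'M[R]_m) V : D Y -> K (ptV m Y V).
  by move=> DY; have [] := smptV _ Y V (Dsym DY); exists m, Y, V.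
have cK : cone_closed K.
  split=> [u v [m1 [Y1 [V1 [D1 n1 j1]]]] [m2 [Y2 [V2 [D2 n2 j2]]]]|s u s0 [m [Y [V [DY nV jV]]]]].
    exists (m1 + m2)%N, (fun j => block_mx (Y1 j) 0 0 (Y2 j)), (col_mx V1 V2).
    split=> [||j]; first exact: Dsum.
      by rewrite smD n1 n2 tr_col_mx mul_row_col.
    rewrite smD j1 j2 tr_col_mx mul_row_block !mulmx0 addr0 add0r mul_row_col.
    by [].
  exists m, Y, (Num.sqrt s *: V); split=> // [|j].
    by rewrite smZ nV [(_ *: V)^T]linearZ /= -scalemxAl -scalemxAr scalerA -expr2 sqr_sqrtr.
  by rewrite smZ jV [(_ *: V)^T]linearZ /= -!scalemxAl -scalemxAr scalerA -expr2 sqr_sqrtr.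
pose e := ptV n (fun=> 0) Q.
have uK : order_unit K e.
  split=> [|w]; first exact: KptV.
  have [s0 sj] := smptV n (fun=> 0) Q (fun=> trmx0 _ _ _).
  have lift (H : 'M[R]_r) : H^T = H ->
      exists2 H' : 'M[R]_n, H'^T = H' & Q^T *m H' *m Q = H.
    move=> sH; exists (Q *m invmx G *m H *m invmx G *m Q^T).
      by rewrite !trmx_mul !trmx_inv sG sH trmxK !mulmxA.
    by rewrite !mulmxA -/G mulmxV // mul1mx -!mulmxA -/G mulVmx // mulmx1.
  have smsym f o : (sm f o)^T = sm f o by rewrite /sm linearD /= trmxK addrC.
  have [H0 sH0 H0E] := lift _ (smsym w None).
  have [t1 [l [U [t10 UE]]]] := sym_shift_gram sH0.
  have /choice [Z ZE] j : exists Z : 'M[R]_n, Z^T = Z /\ Q^T *m Z *m Q = sm w (Some j).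
    by have [Z] := lift _ (smsym w (Some j)); exists Z.
  have [eps eps0 DZ] := Dcore (fun j => proj1 (ZE j)).
  have e1 : eps^-1 * eps = 1 by rewrite mulVf ?gt_eqF.
  (* The zero block with [U *m Q] adjusts the Gram matrix. The block [eps *: Z j], weighted by
     [eps^-1], yields the prescribed [j] parts and costs [eps^-1] copies of [G]. *)
  exists (t1 + eps^-1).
  exists (l + n)%N, (fun j => block_mx 0 0 0 (eps *: Z j)),
    (col_mx (U *m Q) (Num.sqrt eps^-1 *: Q)); split=> [||j]; first exact: Dsum.
    rewrite smD smZ s0 tr_col_mx mul_row_col scalerDl.
    rewrite [(_ *: Q)^T]linearZ /= -scalemxAl -scalemxAr.
    rewrite scalerA -expr2 sqr_sqrtr ?invr_ge0 ?(ltW eps0) // addrAC; congr (_ + _).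
    rewrite trmx_mul !mulmxA -(mulmxA Q^T) -UE mulmxDr mulmxDl H0E.
    by rewrite mul_mx_scalar -scalemxAl.
  rewrite smD smZ sj tr_col_mx mul_row_block !mulmx0 mul0mx scaler0.
  rewrite !add0r mul_row_col mul0mx add0r.
  rewrite [(_ *: Q)^T]linearZ /= -!(scalemxAl, scalemxAr) !scalerA.
  by rewrite mulrA -expr2 sqr_sqrtr ?invr_ge0 ?(ltW eps0) // e1 scale1r (proj2 (ZE j)).
pose x := ptV n X Q.
have nKx : ~ K x.
  move=> [m [Y [V [DY nV jV]]]]; have [s0 sj] := smptV n X Q sX.
  by apply: (nX m Y V DY) => [|j]; rewrite -?nV -?jV.
have [c [Kc ce cx]] := cone_separation cK uK nKx.
pose C o : 'M[R]_r := \matrix_(a, b) c (o, (a, b)).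
(* One factor 1/2 averages [C o] with its transpose, the other reproduces the [2^-1] of [pt]. *)
pose Cs o := 4^-1 *: (C o + (C o)^T).
have sCs o : (Cs o)^T = Cs o.
  by rewrite [(_ *: _)^T]linearZ /= [(_ + _)^T]linearD /= trmxK addrC.
have cE F : (forall o, (F o)^T = F o) ->
    \sum_i c i * pt F i = \sum_o \tr (Cs o *m F o).
  move=> sF.
  rewrite (eq_bigr (fun i => c (i.1, (i.2.1, i.2.2)) * (2^-1 * F i.1 i.2.1 i.2.2))); last first.
    by move=> [o [a b]] _; rewrite ffunE.
  rewrite -(pair_bigA _ (fun o ab => c (o, (ab.1, ab.2)) * (2^-1 * F o ab.1 ab.2))) /=.
  apply: eq_bigr => o _.
  rewrite -(pair_bigA _ (fun a b => c (o, (a, b)) * (2^-1 * F o a b))) /=.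
  have E1 : \tr (C o *m F o) = \sum_a \sum_b c (o, (a, b)) * F o a b.
    rewrite /mxtrace; apply: eq_bigr => a _; rewrite mxE; apply: eq_bigr => b _.
    by rewrite mxE -{1}(sF o) mxE.
  have E2 : \tr ((C o)^T *m F o) = \tr (C o *m F o).
    by rewrite -mxtrace_tr trmx_mul trmxK sF mxtrace_mulC.
  rewrite -scalemxAl mulmxDl mxtraceZ mxtraceD E2 E1.
  under eq_bigr do under eq_bigr do rewrite mulrCA.
  under eq_bigr do rewrite -mulr_sumr.
  by rewrite -mulr_sumr; lra.
have cpt m (Y : 'I_g -> 'M[R]_m) V : (forall j, (Y j)^T = Y j) ->
    \sum_i c i * ptV m Y V i =
    \tr (Cs None *m (V^T *m V)) - \sum_j \tr (- Cs (Some j) *m (V^T *m Y j *m V)).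
  move=> sY; rewrite cE; last by case=> [j|]; rewrite !trmx_mul trmxK // sY mulmxA.
  rewrite (bigID (fun o => o == None)) /= big_pred1_eq; congr (_ + _).
  rewrite -sumrN (reindex_omap Some id) /=; last by case.
  by apply: eq_big => [j|j _]; rewrite ?eqxx // mulNmx raddfN /= opprK.
exists (Cs None), (fun j => - Cs (Some j)).
have TG : \tr (Cs None *m G) = 1.
  have := cpt n (fun=> 0) Q (fun=> trmx0 _ _ _); rewrite ce.
  rewrite [X in _ - X]big1 ?subr0 // => j _.
  by rewrite mulmx0 mul0mx mulmx0 mxtrace0.
split=> //.
- by split=> // j; rewrite [(- _)^T]linearN /= sCs.
- by move=> m Y V DY; rewrite -subr_ge0 -cpt; [apply/Kc/KptV | apply: Dsym].
- by move: cx; rewrite cpt // -/G TG subr_le0.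
Qed.

(* Restricting to the support of [T] turns the homogeneous pencil
   [T - sum_j B_j x_j] into a monic one. *)
Lemma matrix_convex_separation r n (X : 'I_g -> 'M[R]_n) (Q : 'M[R]_(n, r)) :
  Q^T *m Q \in unitmx -> (forall j, (X j)^T = X j) ->
  (forall m (Y : 'I_g -> 'M[R]_m) V, D Y -> V^T *m V = Q^T *m Q ->
     ~ (forall j, V^T *m Y j *m V = Q^T *m X j *m Q)) ->
  exists l (A : 'I_g -> 'M[R]_l) (S : 'M[R]_(l, r)),
    [/\ (forall j, (A j)^T = A j),
        forall m (Y : 'I_g -> 'M[R]_m) V, D Y -> 0 <= pform A Y V,
        Q *m S^T != 0 & pform A X (Q *m S^T) <= 0].
Proof.
move=> uG sX nX.
have [T [B [[sT sB] TB TQ BQ]]] := gram_cone_separation uG sX nX.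
have trq (M : 'M[R]_r) (v : 'cV[R]_r) : \tr (M *m (v *m v^T)) = (v^T *m M *m v) 0 0.
  by rewrite mulmxA mxtrace_mulC mulmxA /mxtrace big_ord1.
have psdT : psdmx T.
  split=> // v; have := TB 1%N (fun=> 0) v^T (D0 1); rewrite trmxK trq.
  by rewrite big1 // => j _; rewrite mulmx0 mul0mx mulmx0 mxtrace0.
(* Points of size 1 on both sides of 0 along axis [j] make [T - e1 *: B j] and [T + e2 *: B j]
   positive semidefinite. A kernel vector of [T] is then isotropic for [B j], so it lies in the
   kernel of [T - e1 *: B j]. *)
have kerB j u : T *m u = 0 -> B j *m u = 0 :> 'cV_r.
  move=> Tu.
  have [|e1 e10 De1] := @Dcore 1 (fun i => (i == j)%:R%:M).
    by move=> i; rewrite tr_scalar_mx.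
  have [|e2 e20 De2] := @Dcore 1 (fun i => - (i == j)%:R%:M).
    by move=> i; rewrite [(- _)^T]linearN /= tr_scalar_mx.
  have E (s : R) (v : 'cV[R]_r) : \sum_i \tr (B i *m (v *m (s *: (i == j)%:R%:M) *m v^T))
      = s * (v^T *m B j *m v) 0 0.
    rewrite (bigD1 j) //= eqxx big1 ?addr0 => [|i ij]; last first.
      by rewrite (negbTE ij) raddf0 scaler0 mulmx0 mul0mx mulmx0 mxtrace0.
    by rewrite -scalemxAr mulmx1 -scalemxAl -scalemxAr mxtraceZ trq.
  have psd1 : psdmx (T - e1 *: B j).
    split; first by rewrite [(_ - _)^T]linearB /= [(_ *: _)^T]linearZ /= sT sB.
    move=> v; have := TB _ _ v^T De1; rewrite trmxK trq E -subr_ge0.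
    by rewrite mulmxBr mulmxBl -scalemxAr -scalemxAl !mxE.
  have psd2 : psdmx (T + e2 *: B j).
    split; first by rewrite [(_ + _)^T]linearD /= [(_ *: _)^T]linearZ /= sT sB.
    move=> v; have := TB _ _ v^T De2; rewrite trmxK trq.
    under eq_bigr do rewrite -scaleN1r scalerA mulrN1.
    rewrite E -subr_ge0 mulNr opprK.
    by rewrite mulmxDr mulmxDl -scalemxAr -scalemxAl !mxE.
  have uB : (u^T *m B j *m u) 0 0 = 0.
    have := psd1.2 u; have := psd2.2 u.
    rewrite !(mulmxBr, mulmxDr) !(mulmxBl, mulmxDl) -!mulmxA Tu mulmx0 !add0r.
    rewrite -!(scalemxAl, scalemxAr) !mxE; set z := \sum_ _ _; nra.
  have := psdmx_ker psd1 (_ : (u^T *m (T - e1 *: B j) *m u) 0 0 = 0).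
  rewrite mulmxBr mulmxBl -mulmxA Tu mulmx0 add0r -scalemxAr -scalemxAl.
  rewrite [X in X = 0 -> _]mxE [X in - X]mxE uB mulr0 oppr0 => /(_ erefl).
  rewrite mulmxBl Tu add0r -scalemxAl => /eqP.
  by rewrite oppr_eq0 scaler_eq0 gt_eqF //= => /eqP.
have [l [S [U [TE SU]]]] := psdmx_factor psdT.
pose A j := U^T *m B j *m U.
have AE j : S^T *m A j *m S = B j.
  have h : B j *m (U *m S) = B j.
    apply/eqP; rewrite -subr_eq0 -[X in _ - X]mulmx1 -mulmxBr; apply/eqP/matrixP => a b.
    have : B j *m col b (U *m S - 1%:M) = 0.
      apply: kerB; rewrite colE mulmxA mulmxBr mulmx1 TE -mulmxA (mulmxA S) SU mul1mx.
      by rewrite subrr mul0mx.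
    by rewrite colE mulmxA -colE => /matrixP/(_ a 0); rewrite mxE => ->; rewrite !mxE.
  rewrite /A !mulmxA -trmx_mul -!mulmxA h.
  by have := congr1 trmx h; rewrite (trmx_mul (B j)) sB.
have pS m (Y : 'I_g -> 'M[R]_m) V :
    pform A Y (V *m S^T) = \tr (T *m (V^T *m V)) - \sum_j \tr (B j *m (V^T *m Y j *m V)).
  rewrite /pform trmx_mul trmxK; congr (_ - _).
    by rewrite TE -[in RHS]mulmxA [RHS]mxtrace_mulC !mulmxA.
  apply: eq_bigr => j _.
  by rewrite -AE -![in RHS]mulmxA [RHS]mxtrace_mulC !mulmxA.
exists l, A, S; split.
- by move=> j; rewrite !trmx_mul trmxK sB mulmxA.
(* Since [S *m U = 1], every [V] factors through [S^T], so the homogeneous inequality covers all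
   vectors. *)
- move=> m Y V DY; have -> : V = V *m U^T *m S^T by rewrite -mulmxA -trmx_mul SU trmx1 mulmx1.
  by rewrite pS subr_ge0; apply: TB.
- apply: contraTneq (oner_neq0 R) => QS.
  have := pS _ (fun=> 0) Q; rewrite QS TQ /pform mulmx0 mxtrace0.
  rewrite !big1 ?subr0 => [<-|j _|j _]; first by rewrite negbK.
  + by rewrite mulmx0 mul0mx mulmx0 mxtrace0.
  + by rewrite mulmx0 mulmx0 mxtrace0.
- by rewrite pS TQ subr_le0.
Qed.

End Separation.

(** * The action of a matrix polynomial *)

Lemma unitmx_kerP (F : fieldType) n (M : 'M[F]_n) :
  reflect (forall v : 'cV[F]_n, M *m v = 0 -> v = 0) (M \in unitmx).
Proof.
apply: (iffP idP) => [uM v Mv|h].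
  by rewrite -[v]mul1mx -(mulVmx uM) -mulmxA Mv mulmx0.
rewrite -unitmx_tr -row_free_unit -kermx_eq0; apply/eqP/row_matrixP => i.
apply: trmx_inj; rewrite row0 trmx0; apply: h; apply: trmx_inj.
by rewrite trmx_mul trmxK -row_mul mulmx_ker row0 trmx0.
Qed.

(** * Finiteness of roots and gaps between them *)

Section PolyRoots.
Variable R : realFieldType.

Lemma poly_root_seq (q : {poly R}) : q != 0 -> exists s : seq R, forall x, root q x -> x \in s.
Proof.
move: {2}(size q) (leqnn (size q)) => n; elim: n q => [|n IH] q.
  by rewrite leqn0 size_poly_eq0 => ->.
move=> sq q0; case: (pselect (exists x, root q x)) => [[x /factor_theorem [q' qE]]|nx].
  have q'0 : q' != 0 by apply: contraNneq q0 => q'0; rewrite qE q'0 mul0r.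
  have [|s hs] := IH q' _ q'0.
    by move: sq; rewrite qE size_Mmonic ?monicXsubC // size_XsubC addn2.
  exists (x :: s) => y; rewrite qE rootM root_XsubC inE orbC => /orP[->//|/hs ->].
  by rewrite orbT.
by exists [::] => x qx; case: nx; exists x.
Qed.

Lemma seq_gap (s : seq R) a : exists2 b, a < b & forall x, x \in s -> a < x -> b <= x.
Proof.
elim: s => [|y s [b ab hb]]; first by exists (a + 1); rewrite ?ltrDl.
case: (ltrP a y) => ay.
  exists (Num.min y b) => [|x]; first by rewrite lt_min ay.
  rewrite inE => /orP[/eqP -> _|xs ax]; first by rewrite ge_min lexx.
  by rewrite ge_min (hb _ xs ax) orbT.
exists b => // x; rewrite inE => /orP[/eqP -> |]; [by rewrite ltNge ay | exact: hb].
Qed.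

Lemma seq_least (s : seq R) (P : R -> Prop) x : x \in s -> P x ->
  exists2 y, P y & forall z, z \in s -> P z -> y <= z.
Proof.
elim: s x => [//|a s IH] x.
case: (pselect (exists2 z, z \in s & P z)) => [[z zs Pz] _ _|ns].
  have [y Py hy] := IH z zs Pz.
  case: (pselect (P a)) => [Pa|nPa]; last first.
    exists y => // u; rewrite inE => /orP[/eqP -> //|]; exact: hy.
  exists (Num.min a y) => [|u]; first by case: leP.
  rewrite inE => /orP[/eqP -> _|us Pu]; first by rewrite ge_min lexx.
  by rewrite ge_min (hy _ us Pu) orbT.
rewrite inE => /orP[/eqP -> Pa|xs Px]; last by case: ns; exists x.
exists a => // z; rewrite inE => /orP[/eqP -> //|zs Pz]; by case: ns; exists z.
Qed.

End PolyRoots.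

(** * Evaluation on tensor vectors, direct sums and rays *)

Section MatrixPolyAction.
Variables (R : realType) (g d : nat) (p : 'M[freepoly R g]_d).

Lemma word_eval_nil n (X : 'I_g -> 'M[R]_n) : word_eval X [::] = 1%:M.
Proof. by rewrite /word_eval big_nil. Qed.

Lemma word_eval_cons n (X : 'I_g -> 'M[R]_n) j w :
  word_eval X (j :: w) = X j *m word_eval X w.
Proof. by rewrite /word_eval big_cons. Qed.

Lemma word_eval_scale n (X : 'I_g -> 'M[R]_n) t w :
  word_eval (fun j => t *: X j) w = t ^+ size w *: word_eval X w.
Proof.
elim: w => [|j w IH]; first by rewrite !word_eval_nil scale1r.
by rewrite !word_eval_cons IH -scalemxAl -scalemxAr scalerA exprS.
Qed.

Lemma word_eval_block n1 n2 (X1 : 'I_g -> 'M[R]_n1) (X2 : 'I_g -> 'M[R]_n2) c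
    (N1 : 'M[R]_(n1, c)) (N2 : 'M[R]_(n2, c)) w :
  word_eval (fun j => block_mx (X1 j) 0 0 (X2 j)) w *m col_mx N1 N2 =
  col_mx (word_eval X1 w *m N1) (word_eval X2 w *m N2).
Proof.
elim: w => [|j w IH]; first by rewrite !word_eval_nil !mul1mx.
by rewrite !word_eval_cons -mulmxA IH mul_block_col !mul0mx addr0 add0r !mulmxA.
Qed.

(* [p(X)] acting on [R^d (x) R^n], whose vectors are written as [n x d] matrices. *)
Definition pact n (X : 'I_g -> 'M[R]_n) (N : 'M[R]_(n, d)) : 'M[R]_(n, d) :=
  \sum_(w <- mxsupp p) word_eval X w *m N *m (mxcoef p w)^T.

Definition tensvec a b (N : 'M[R]_(b, a)) : 'cV[R]_(a * b) :=
  \col_i N (mxtens_unindex i).2 (mxtens_unindex i).1.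

Definition vectens a b (v : 'cV[R]_(a * b)) : 'M[R]_(b, a) :=
  \matrix_(k, i) v (mxtens_index (i, k)) 0.

Lemma tensvecK a b : cancel (@tensvec a b) (@vectens a b).
Proof. by move=> N; apply/matrixP => k i; rewrite !mxE mxtens_indexK. Qed.

Lemma vectensK a b : cancel (@vectens a b) (@tensvec a b).
Proof.
move=> v; apply/matrixP => i k; rewrite !mxE ord1.
by case: (mxtens_indexP i) => u w; rewrite mxtens_indexK.
Qed.

Lemma tensmx_tensvec a b (A : 'M[R]_a) (B : 'M[R]_b) (N : 'M[R]_(b, a)) :
  tensmx A B *m tensvec N = tensvec (B *m N *m A^T).
Proof.
apply/matrixP => i z; rewrite {z}ord1; case: (mxtens_indexP i) => u w.
rewrite !mxE mxtens_indexK /=.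
rewrite (reindex (fun x => @mxtens_index a b x)) /=; last first.
  by exists (@mxtens_unindex a b) => x _; rewrite ?mxtens_indexK ?mxtens_unindexK.
transitivity (\sum_x \sum_y A u x * B w y * N y x).
  rewrite pair_bigA; apply: eq_bigr => -[x y] _.
  by rewrite tensmxE mxE mxtens_indexK.
apply: eq_bigr => x _; rewrite !mxE mulr_suml; apply: eq_bigr => y _.
by rewrite -mulrA mulrC.
Qed.

Lemma tensvec_sum a b I (s : seq I) (F : I -> 'M[R]_(b, a)) :
  tensvec (\sum_(i <- s) F i) = \sum_(i <- s) tensvec (F i).
Proof.
apply/matrixP => i j; rewrite summxE !mxE summxE.
by apply: eq_bigr => k _; rewrite mxE.
Qed.

Lemma tensvec0 a b : tensvec (0 : 'M[R]_(b, a)) = 0.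
Proof. by apply/matrixP => i j; rewrite !mxE. Qed.

Lemma peval_tensvec n (X : 'I_g -> 'M[R]_n) N :
  peval p X *m tensvec N = tensvec (pact X N).
Proof.
rewrite /peval /pact mulmx_suml tensvec_sum.
by apply: eq_bigr => w _; rewrite tensmx_tensvec.
Qed.

Lemma peval_unitP n (X : 'I_g -> 'M[R]_n) :
  reflect (forall N, pact X N = 0 -> N = 0) (peval p X \in unitmx).
Proof.
apply: (iffP (unitmx_kerP _)) => h.
  move=> N XN; rewrite -[N]tensvecK (h (tensvec N)) ?peval_tensvec ?XN ?tensvec0 //.
  by apply/matrixP => i j; rewrite !mxE.
move=> v; rewrite -[v]vectensK peval_tensvec => Xv; rewrite (h (vectens v)) ?tensvec0 //.
rewrite -[pact _ _]tensvecK Xv; apply/matrixP => i j; rewrite !mxE.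
by [].
Qed.

Lemma pact0 n (N : 'M[R]_(n, d)) : pact (fun=> 0) N = N *m (mxcoef p [::])^T.
Proof.
have w0 (w : word g) : w != [::] -> word_eval (fun=> 0 : 'M[R]_n) w = 0 :> 'M_n.
  by case: w => // j w _; rewrite word_eval_cons mul0mx.
rewrite /pact; case: (boolP ([::] \in mxsupp p)) => h.
  rewrite (big_fsetD1 ([::] : word g)) //= word_eval_nil mul1mx big1_fset ?addr0 //.
  by move=> w; rewrite in_fsetD1 => /andP[wn _] _; rewrite w0 // !mul0mx.
move: (h); rewrite mem_mxsupp negbK => /eqP ->; rewrite trmx0 mulmx0.
rewrite big1_fset // => w ws _; rewrite w0 ?mul0mx //.
by apply: contraNneq h => <-.
Qed.

Lemma pact_block n1 n2 (X1 : 'I_g -> 'M[R]_n1) (X2 : 'I_g -> 'M[R]_n2) N1 N2 :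
  pact (fun j => block_mx (X1 j) 0 0 (X2 j)) (col_mx N1 N2) =
  col_mx (pact X1 N1) (pact X2 N2).
Proof.
rewrite /pact; elim: (enum_fset _) => [|w s IH]; first by rewrite !big_nil col_mx0.
by rewrite !big_cons IH word_eval_block mul_col_mx add_col_mx.
Qed.

(** Each word is homogeneous in [t]. Hence a ray on which the polynomial is nonzero has only
    finitely many singular parameters. *)
Lemma det_peval_ray n (X : 'I_g -> 'M[R]_n) : exists q : {poly R},
  forall t, q.[t] = \det (peval p (fun j => t *: X j)).
Proof.
exists (\det (\sum_(w <- mxsupp p) 'X^(size w) *:
  map_mx polyC (tensmx (mxcoef p w) (word_eval X w)))).
move=> t; rewrite -horner_evalE -det_map_mx; congr (\det _).
rewrite /peval raddf_sum; apply: eq_bigr => w _ /=.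
apply/matrixP => i j; rewrite !mxE word_eval_scale.
by rewrite /= horner_evalE hornerM hornerXn hornerC !mxE mulrCA.
Qed.

End MatrixPolyAction.

(** * The star-shaped domain of invertibility *)

Section StarDomain.
Variables (R : realType) (g d : nat) (p : 'M[freepoly R g]_d).
Hypothesis p0_unit : mxcoef p [::] \in unitmx.

Definition scaletup n (t : R) (X : 'I_g -> 'M[R]_n) : 'I_g -> 'M[R]_n :=
  fun j => t *: X j.

Lemma scaletup1 n (X : 'I_g -> 'M[R]_n) : scaletup 1 X = X.
Proof. by apply/funext => j; rewrite /scaletup scale1r. Qed.

Lemma scaletupA n s t (X : 'I_g -> 'M[R]_n) :
  scaletup s (scaletup t X) = scaletup (s * t) X.
Proof. by apply/funext => j; rewrite /scaletup scalerA. Qed.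

Lemma symtuple_scale n t (X : 'I_g -> 'M[R]_n) : symtuple X -> symtuple (scaletup t X).
Proof. by move=> sX j; rewrite linearZ /= sX. Qed.

(* When the invertibility set is convex, it is this set: it is star-shaped
   about 0, so the whole segment from 0 must stay invertible. *)
Definition stardom n (X : 'I_g -> 'M[R]_n) : Prop :=
  symtuple X /\
  forall t, 0 <= t <= 1 -> peval p (scaletup t X) \in unitmx.

(** A closure taken along rays from 0 only; it contains every first exit point of a ray. *)
Definition starclos n (X : 'I_g -> 'M[R]_n) : Prop :=
  symtuple X /\ forall t, 0 <= t < 1 -> stardom (scaletup t X).

Lemma stardom_scale n s (X : 'I_g -> 'M[R]_n) :
  stardom X -> 0 <= s <= 1 -> stardom (scaletup s X).
Proof.
move=> [sX uX] /andP[s0 s1]; split; first exact: symtuple_scale.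
move=> t /andP[t0 t1]; rewrite scaletupA; apply: uX.
by rewrite mulr_ge0 //= mulr_ile1.
Qed.

Lemma stardom_block n1 n2 (X1 : 'I_g -> 'M[R]_n1) (X2 : 'I_g -> 'M[R]_n2) :
  stardom X1 -> stardom X2 -> stardom (fun j => block_mx (X1 j) 0 0 (X2 j)).
Proof.
move=> [s1 u1] [s2 u2]; split=> [j|t t01].
  by rewrite tr_block_mx !trmx0 s1 s2.
have -> : scaletup t (fun j => block_mx (X1 j) 0 0 (X2 j)) =
    (fun j => block_mx (scaletup t X1 j) 0 0 (scaletup t X2 j)).
  by apply/funext => j; rewrite /scaletup scale_block_mx !scaler0.
apply/peval_unitP => N; rewrite -[N]vsubmxK pact_block -col_mx0.
move=> /eq_col_mx [/(elimT (peval_unitP _ _) (u1 t t01)) ->].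
by move=> /(elimT (peval_unitP _ _) (u2 t t01)) ->.
Qed.

Lemma starclos_block n1 n2 (X1 : 'I_g -> 'M[R]_n1) (X2 : 'I_g -> 'M[R]_n2) :
  starclos X1 -> starclos X2 -> starclos (fun j => block_mx (X1 j) 0 0 (X2 j)).
Proof.
move=> [s1 c1] [s2 c2]; split=> [j|t t01].
  by rewrite tr_block_mx !trmx0 s1 s2.
have := stardom_block (c1 t t01) (c2 t t01); congr stardom.
by apply/funext => j; rewrite /scaletup scale_block_mx !scaler0.
Qed.

Lemma peval0_unit n : peval p (fun=> 0 : 'M[R]_n) \in unitmx.
Proof.
apply/peval_unitP => N; rewrite pact0 => Np.
rewrite -[N]mulmx1 -(mulmxV (_ : (mxcoef p [::])^T \in unitmx)) ?unitmx_tr //.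
by rewrite mulmxA Np mul0mx.
Qed.

Lemma scaletup0 n (X : 'I_g -> 'M[R]_n) : scaletup 0 X = fun=> 0.
Proof. by apply/funext => j; rewrite /scaletup scale0r. Qed.

Lemma ray_roots n (X : 'I_g -> 'M[R]_n) : exists s : seq R,
  forall t, peval p (scaletup t X) \notin unitmx -> t \in s.
Proof.
have [q qE] := det_peval_ray p X.
have q0 : q != 0.
  apply/eqP => q0; have := peval0_unit n.
  by rewrite -(scaletup0 X) unitmxE unitfE -qE q0 horner0 eqxx.
have [s hs] := poly_root_seq q0; exists s => t.
by rewrite unitmxE unitfE -qE negbK => /hs.
Qed.

Lemma stardom_core n (X : 'I_g -> 'M[R]_n) : symtuple X ->
  exists2 e, 0 < e & stardom (scaletup e X).
Proof.
move=> sX; have [s hs] := ray_roots X; have [b b0 hb] := seq_gap s 0.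
have b20 : 0 < b / 2 by rewrite divr_gt0.
exists (b / 2) => //; split; first exact: symtuple_scale.
move=> t /andP[t0 t1]; rewrite scaletupA; move: t0; rewrite le_eqVlt => /orP[/eqP <-|t0].
  by rewrite mul0r scaletup0 peval0_unit.
apply: contraT => /hs ts.
by have := hb _ ts; rewrite mulr_gt0 // => /(_ isT); nra.
Qed.

(** Finitely many singular parameters leave a gap after 1; half of that gap is used. *)
Lemma stardom_extend n (X : 'I_g -> 'M[R]_n) : stardom X ->
  exists2 e, 0 < e & stardom (scaletup (1 + e) X).
Proof.
move=> [sX uX]; have [s hs] := ray_roots X; have [b b1 hb] := seq_gap s 1.
exists ((b - 1) / 2); first by lra.
split; first exact: symtuple_scale.
move=> t /andP[t0 t1]; rewrite scaletupA; set u := t * _.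
case: (lerP u 1) => u1.
  by apply: uX; rewrite u1 andbT /u mulr_ge0 //; lra.
by apply: contraT => /hs /hb /(_ u1); rewrite /u; nra.
Qed.

(** The exit time is the least singular parameter in [[0, 1]]; it is positive because [p(0)] is
    invertible. *)
Lemma stardom_exit n (X : 'I_g -> 'M[R]_n) : symtuple X -> ~ stardom X ->
  exists2 t, 0 < t <= 1 &
    starclos (scaletup t X) /\ exists2 N, N != 0 & pact p (scaletup t X) N = 0.
Proof.
move=> sX nX; have [s hs] := ray_roots X.
pose P t := 0 <= t <= 1 /\ peval p (scaletup t X) \notin unitmx.
have [t [t01 /negP ut]] : exists t, P t.
  apply: contrapT => nP; apply: nX; split=> // t t01; apply: contraT => ut.
  by case: nP; exists t.
have [] := @seq_least _ s P t (hs _ (introN idP ut)) (conj t01 (introN idP ut)).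
move=> {t t01 ut} t [/andP[t0 t1] ut] tmin.
have {}t0 : 0 < t.
  rewrite lt_neqAle t0 andbT; apply: contraNneq ut => <-.
  by rewrite scaletup0 peval0_unit.
exists t; first by rewrite t0.
split.
  split=> [|u /andP[u0 u1]]; first exact: symtuple_scale.
  rewrite scaletupA; split=> [|v /andP[v0 v1]]; first exact: symtuple_scale.
  rewrite scaletupA; apply: contraT => uv.
  have vut : v * (u * t) < t.
    by rewrite mulrA gtr_pMl //; nra.
  have : t <= v * (u * t).
    apply: tmin; first exact: hs.
    split=> //; rewrite (le_trans (ltW vut) t1) andbT.
    by rewrite !mulr_ge0 // ltW.
  by rewrite leNgt vut.
apply: contrapT => nN; move/negP: ut; apply; apply/peval_unitP => N XN.
by apply: contrapT => /eqP N0; apply: nN; exists N.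
Qed.

Hypothesis midconvex : forall n (X Y : 'I_g -> 'M[R]_n),
  stardom X -> stardom Y -> stardom (fun j => 2^-1 *: (X j + Y j)).

(* Averaging with the reflection [2 P - 1] removes the off-diagonal corners. *)
Lemma stardom_compress n (X : 'I_g -> 'M[R]_n) (P : 'M[R]_n) :
  P^T = P -> P *m P = P -> stardom X -> stardom (fun j => P *m X j *m P).
Proof.
move=> sP PP DX; have [sX uX] := DX.
pose U : 'M[R]_n := P + P - 1%:M.
have sU : U^T = U by rewrite !linearB !linearD /= sP trmx1.
have UU : U *m U = 1%:M.
  rewrite /U mulmxBl mulmxBr mulmxDr !mulmxDl !PP !mulmx1 mul1mx.
  by rewrite addrK opprB addrCA subrr addr0.
have DU : stardom (fun j => U *m X j *m U).
  split=> [j|t t01]; first by rewrite !trmx_mul sU sX mulmxA.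
  have E w : word_eval (scaletup t (fun j => U *m X j *m U)) w =
             U *m word_eval (scaletup t X) w *m U.
    elim: w => [|j w IH]; first by rewrite !word_eval_nil mulmx1 UU.
    rewrite !word_eval_cons IH /scaletup -!(scalemxAl, scalemxAr) !mulmxA.
    by rewrite -(mulmxA (U *m X j)) UU mulmx1.
  apply/peval_unitP => N XN.
  have /(elimT (peval_unitP _ _) (uX t t01)) : pact p (scaletup t X) (U *m N) = 0.
    have := congr1 (mulmx U) XN; rewrite mulmx0 /pact mulmx_sumr => EE.
    rewrite -[RHS]EE; apply: eq_bigr => w _.
    by rewrite E !mulmxA UU mul1mx.
  by move/(congr1 (mulmx U)); rewrite mulmxA UU mul1mx mulmx0.
have := midconvex DX DU; set Z := fun j => _ => -[sZ uZ].
(* The average [Z] of [X] and its reflection agrees with the compression on the range of [P], which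
   it preserves. *)
have PZ j : P *m X j *m P = Z j *m P.
  rewrite /Z -scalemxAl mulmxDl -!mulmxA.
  have -> : U *m P = P by rewrite /U mulmxBl mulmxDl PP mul1mx addrK.
  rewrite /U mulmxBl mul1mx addrC subrK mulmxDl -mulr2n -scaler_nat scalerA.
  by rewrite mulVf ?pnatr_eq0 // scale1r.
have PZP j : P *m Z j *m P = Z j *m P by rewrite -mulmxA -PZ !mulmxA PP.
split=> [j|t t01]; first by rewrite !trmx_mul sP sX mulmxA.
apply/peval_unitP => N; set Y := scaletup t _ => YN.
have YP j : P *m Y j = Y j *m P.
  by rewrite /Y /scaletup -scalemxAr -scalemxAl -!mulmxA PP !mulmxA PP.
have PY w : P *m word_eval Y w = word_eval Y w *m P.
  elim: w => [|j w IH]; first by rewrite !word_eval_nil mul1mx mulmx1.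
  by rewrite !word_eval_cons mulmxA YP -mulmxA IH mulmxA.
have ZP w : word_eval Y w *m P = word_eval (scaletup t Z) w *m P.
  elim: w => [|j w IH]; first by rewrite !word_eval_nil.
  have -> : word_eval Y (j :: w) = scaletup t Z j *m P *m word_eval Y w.
    by rewrite word_eval_cons; congr (_ *m _); rewrite /Y /scaletup PZ -scalemxAl.
  by rewrite word_eval_cons -!mulmxA (mulmxA P) PY -mulmxA PP IH.
have PN : P *m N = 0.
  apply: (elimT (peval_unitP _ _) (uZ t t01)).
  have := congr1 (mulmx P) YN; rewrite mulmx0 /pact mulmx_sumr => EE.
  rewrite -[RHS]EE; apply: eq_bigr => w _.
  by rewrite !mulmxA PY ZP.
(* As [P *m N = 0], every nonempty word at [Y] kills [N], so only the constant term of [p] is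
   left. *)
apply: (elimT (peval_unitP _ _) (peval0_unit n)).
rewrite -[RHS]YN /pact; apply: eq_bigr => -[|j w] _; first by rewrite !word_eval_nil.
rewrite !word_eval_cons !mul0mx.
have -> : Y j = Y j *m P by rewrite /Y /scaletup -scalemxAl -!mulmxA PP.
by rewrite -(mulmxA (Y j)) PY -!mulmxA (mulmxA P N) PN mul0mx !mulmx0.
Qed.

End StarDomain.

(** * Pencils singular on the boundary *)

Section WordMatrix.
Variables (R : realType) (g d : nat).

Definition wordidx k : finType := (k.-bseq 'I_g * 'I_d)%type.

(** Its column space is the span of the columns of the [w(X) N]; its right kernel consists of the
    coefficients of the polynomials of degree at most [k] that kill [(X, N)]. *)
Definition wordmx k n (X : 'I_g -> 'M[R]_n) (N : 'M[R]_(n, d)) :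
    'M[R]_(n, #|wordidx k|) :=
  \matrix_(a, i) let wb : wordidx k := enum_val i in (word_eval X wb.1 *m N) a wb.2.

(** Words longer than [k] fall back to a default index, hence the length bounds in the lemmas on
    evaluation. *)
Definition wordblock k n (M : 'M[R]_(n, #|wordidx k|)) (w : word g) : 'M[R]_(n, d) :=
  \matrix_(a, i) M a (enum_rank ((insub_bseq k w, i) : wordidx k)).

Lemma wordblock_mul k m n (D : 'M[R]_(m, n)) (M : 'M[R]_(n, #|wordidx k|)) w :
  wordblock (D *m M) w = D *m wordblock M w.
Proof. by apply/matrixP => a i; rewrite !mxE; apply: eq_bigr => b _; rewrite mxE. Qed.

Lemma wordblock_wordmx k n (X : 'I_g -> 'M[R]_n) N w : (size w <= k)%N ->
  wordblock (wordmx k X N) w = word_eval X w *m N.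
Proof.
move=> wk; apply/matrixP => a i; rewrite !mxE enum_rankK /=.
by rewrite /insub_bseq insubdK ?mxE.
Qed.

Lemma wordblock_inj k n (M M' : 'M[R]_(n, #|wordidx k|)) :
  (forall w, (size w <= k)%N -> wordblock M w = wordblock M' w) -> M = M'.
Proof.
move=> h; apply/matrixP => a i; case E : (enum_val i) => [w b].
have /matrixP/(_ a b) := h w (size_bseq w); rewrite !mxE.
have -> : insub_bseq k w = w.
  by apply: val_inj; rewrite /insub_bseq insubdK //; apply: size_bseq.
by rewrite -E enum_valK.
Qed.

Lemma wordmx_block k n1 n2 (X1 : 'I_g -> 'M[R]_n1) (X2 : 'I_g -> 'M[R]_n2) N1 N2 :
  wordmx k (fun j => block_mx (X1 j) 0 0 (X2 j)) (col_mx N1 N2) =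
  col_mx (wordmx k X1 N1) (wordmx k X2 N2).
Proof.
apply/matrixP => a i; rewrite mxE /= word_eval_block !mxE.
by case: (fintype.split a) => b; rewrite [RHS]mxE.
Qed.

(** The spare degree pays for one letter: [D] then intertwines [X j] with [Y j] on words of length
    at most [k]. *)
Lemma wordmx_transfer k m n (X : 'I_g -> 'M[R]_n) N (Y : 'I_g -> 'M[R]_m) N' D :
  D *m wordmx k.+1 X N = wordmx k.+1 Y N' ->
  D *m wordmx k X N = wordmx k Y N' /\
  forall j, D *m (X j *m wordmx k X N) = Y j *m wordmx k Y N'.
Proof.
move=> E; have h w : (size w <= k.+1)%N -> D *m (word_eval X w *m N) = word_eval Y w *m N'.
  by move=> wk; rewrite -!(@wordblock_wordmx k.+1) // -E wordblock_mul.
split=> [|j]; apply: wordblock_inj => w wk; rewrite !wordblock_mul !wordblock_wordmx //.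
  by rewrite h // ltnW.
by have := h (j :: w) wk; rewrite !word_eval_cons !mulmxA.
Qed.

End WordMatrix.

Section Pforms.
Variables (R : realType) (g : nat).

Lemma pform_scale l m (A : 'I_g -> 'M[R]_l) (Y : 'I_g -> 'M[R]_m) t V :
  pform A (scaletup t Y) V = (1 - t) * \tr (V^T *m V) + t * pform A Y V.
Proof.
have E : \sum_j \tr (A j *m (V^T *m scaletup t Y j *m V)) =
    t * \sum_j \tr (A j *m (V^T *m Y j *m V)).
  rewrite mulr_sumr; apply: eq_bigr => j _.
  by rewrite /scaletup -scalemxAr -scalemxAl -scalemxAr mxtraceZ.
by rewrite /pform E; ring.
Qed.

Lemma pform_row l1 l2 m (A1 : 'I_g -> 'M[R]_l1) (A2 : 'I_g -> 'M[R]_l2)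
    (Y : 'I_g -> 'M[R]_m) V1 V2 :
  pform (fun j => block_mx (A1 j) 0 0 (A2 j)) Y (row_mx V1 V2) =
  pform A1 Y V1 + pform A2 Y V2.
Proof.
rewrite /pform tr_row_mx mul_col_row mxtrace_block addrACA -opprD -big_split /=.
congr (_ - _); apply: eq_bigr => j _.
by rewrite (mul_col_mx V1^T) mul_col_row mulmx_block !mul0mx addr0 mxtrace_block add0r.
Qed.

Lemma sum_mul_row_block l1 l2 m (A1 : 'I_g -> 'M[R]_l1) (A2 : 'I_g -> 'M[R]_l2)
    (Y : 'I_g -> 'M[R]_m) V1 V2 :
  \sum_j Y j *m row_mx V1 V2 *m block_mx (A1 j) 0 0 (A2 j) =
  row_mx (\sum_j Y j *m V1 *m A1 j) (\sum_j Y j *m V2 *m A2 j).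
Proof.
elim/big_rec3: _ => [|j a b _ _ ->]; first by rewrite row_mx0.
by rewrite mul_mx_row mul_row_block !mulmx0 addr0 add0r add_row_mx.
Qed.

Lemma pform_act0 l m (A : 'I_g -> 'M[R]_l) (Y : 'I_g -> 'M[R]_m) V :
  V = \sum_j Y j *m V *m A j -> pform A Y V = 0.
Proof. by move=> E; rewrite pformE /pencil_act -E subrr mulmx0 mxtrace0. Qed.

End Pforms.

(** * Supporting pencils at boundary points and their direct sums *)

Section SingularPencil.
Variables (R : realType) (g d : nat) (p : 'M[freepoly R g]_d).
Hypothesis p0_unit : mxcoef p [::] \in unitmx.
Hypothesis midconvex : forall n (X Y : 'I_g -> 'M[R]_n),
  stardom p X -> stardom p Y -> stardom p (fun j => 2^-1 *: (X j + Y j)).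

Definition detbdry n (X : 'I_g -> 'M[R]_n) (N : 'M[R]_(n, d)) : Prop :=
  [/\ starclos p X, N != 0 & pact p X N = 0].

Variable k : nat.
Hypothesis pk : forall w, w \in mxsupp p -> (size w <= k.+1)%N.

(* If [V] had the same Gram data as [Q] at some [Y] in the domain, then [V]
   would transport the kernel vector [N] of [p(X)] to a kernel vector of [p] at
   the compression of [Y] to the range of [V]. *)
Lemma detbdry_gram n r (X : 'I_g -> 'M[R]_n) N (Q : 'M[R]_(n, r)) (c : word g -> 'M[R]_(r, d)) :
  detbdry X N -> Q^T *m Q \in unitmx ->
  (forall w, (size w <= k)%N -> word_eval X w *m N = Q *m c w) ->
  forall m (Y : 'I_g -> 'M[R]_m) V, stardom p Y -> V^T *m V = Q^T *m Q ->
     ~ (forall j, V^T *m Y j *m V = Q^T *m X j *m Q).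
Proof.
move=> [_ N0 XN]; set G := Q^T *m Q => uG cE m Y V DY VV VYV.
have sG : G^T = G by rewrite trmx_mul trmxK.
pose P := V *m invmx G *m V^T.
have sP : P^T = P by rewrite !trmx_mul trmxK trmx_inv sG mulmxA.
have PV : P *m V = V by rewrite /P -!mulmxA VV mulVmx // mulmx1.
have PP : P *m P = P by rewrite {2}/P !mulmxA PV.
have [_ /(_ 1)] := stardom_compress p0_unit midconvex sP PP DY.
rewrite ler01 lexx scaletup1 => /(_ isT)/peval_unitP uY.
(* The map [V *m invmx G *m Q^T] carries the range of [Q] isometrically onto that of [V]. Length
   [k.+1] is reached because the last letter acts on the range of [Q], and only [Q^T *m X j *m Q]
   enters the comparison. *)
have h w : (size w <= k.+1)%N ->
    word_eval (fun j => P *m Y j *m P) w *m (V *m c [::]) =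
    V *m invmx G *m Q^T *m (word_eval X w *m N).
  elim: w => [|j w IH] wk.
    rewrite word_eval_nil mul1mx cE // -!mulmxA (mulmxA Q^T) -/G.
    by rewrite (mulmxA (invmx G)) mulVmx // mul1mx.
  rewrite !word_eval_cons /= -mulmxA IH; last exact: ltnW.
  rewrite -(mulmxA (X j)) cE // -!mulmxA (mulmxA Q^T Q) -/G (mulmxA V^T V) VV.
  rewrite !(mulmxA (invmx G) G) mulVmx // !mul1mx.
  do 2!congr (_ *m _).
  by rewrite !mulmxA VYV.
have : V *m c [::] = 0.
  apply: uY; rewrite /pact.
  rewrite big_seq.
  rewrite (eq_bigr (fun w => V *m invmx G *m Q^T *m (word_eval X w *m N *m (mxcoef p w)^T))).
    by rewrite -big_seq -mulmx_sumr -/(pact p X N) XN mulmx0.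
  by move=> w /pk wk; rewrite h // !mulmxA.
move/(congr1 (mulmx (invmx G *m V^T))); rewrite mulmx0 mulmxA.
rewrite -(mulmxA _ V^T) VV mulVmx // mul1mx => c0.
by move: N0; rewrite -[N]mul1mx -(word_eval_nil X) cE // c0 mulmx0 eqxx.
Qed.

Definition pos_pencil l (A : 'I_g -> 'M[R]_l) : Prop :=
  (forall j, (A j)^T = A j) /\
  forall m (Y : 'I_g -> 'M[R]_m) V, stardom p Y -> 0 <= pform A Y V.

(** Along the ray the form is affine in the parameter, so nonnegativity on [[0, 1)] passes to 1. *)
Lemma pos_pencil_clos l (A : 'I_g -> 'M[R]_l) m (Y : 'I_g -> 'M[R]_m) V :
  pos_pencil A -> starclos p Y -> 0 <= pform A Y V.
Proof.
move=> [_ pA] [_ cY]; rewrite leNgt; apply/negP => neg.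
have a0 := mxtrace_gram_ge0 V.
have D t : 0 <= t < 1 -> 0 <= (1 - t) * \tr (V^T *m V) + t * pform A Y V.
  by move=> t01; rewrite -pform_scale; apply/pA/cY.
move: (\tr _) (pform _ _ _) neg a0 D => a b b0 a0 D.
have ab : 0 < a - b by lra.
(* The parameter at which the affine function from [a] to [b < 0] takes the value [b / 2]. *)
have := D ((a - b / 2) / (a - b)).
have -> : (1 - (a - b / 2) / (a - b)) * a + (a - b / 2) / (a - b) * b = b / 2.
  by field; rewrite gt_eqF.
rewrite divr_ge0 ?ltr_pdivrMr //=; [|lra|lra].
have -> : a - b / 2 < 1 * (a - b) by lra.
by move=> /(_ isT); lra.
Qed.

(** The separation is applied to a column basis [Q] of the word matrix. The kernel vector is stated
    as [wordmx k X N *m F] so that the same [F] can be tried at other boundary pairs. *)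
Lemma supporting_pencil n (X : 'I_g -> 'M[R]_n) N : detbdry X N ->
  exists l (A : 'I_g -> 'M[R]_l) F, let V := wordmx k X N *m F in
    [/\ pos_pencil A, V != 0 & V = \sum_j X j *m V *m A j].
Proof.
move=> bX; have [cX _ _] := bX; set M := wordmx k X N.
pose Q := col_base M; pose C := row_base M.
have uG : Q^T *m Q \in unitmx.
  apply/unitmx_kerP => v /gram_eq0 Qv.
  by rewrite -[v]mul1mx -(mulVpmx (col_base_full M)) -mulmxA Qv mulmx0.
have cE w : (size w <= k)%N -> word_eval X w *m N = Q *m wordblock C w.
  by move=> wk; rewrite -(wordblock_wordmx _ _ wk) -wordblock_mul mulmx_base.
have [l [A [S [sA pA V0 VX]]]] := matrix_convex_separation
  (fun m (Y : 'I_g -> 'M[R]_m) (DY : stardom p Y) => DY.1)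
  (@stardom_block _ _ _ p) (@stardom_core _ _ _ p p0_unit) uG cX.1 (detbdry_gram bX uG cE).
exists l, A, (pinvmx C *m S^T) => /=.
have -> : M *m (pinvmx C *m S^T) = Q *m S^T.
  by rewrite -{1}(mulmx_base M) mulmxA -(mulmxA Q) mulmxVp ?row_base_free // mulmx1.
split=> //; apply: pform_critical => // [|W]; first exact: cX.1.
by apply: pos_pencil_clos.
Qed.

(* Induction on the largest rank of [wordmx k.+1 X N] over [S]. A point of
   maximal rank dominates all of [S], so its supporting pencil is singular on
   all of [S] except where the transported kernel vector vanishes; there the
   rank is strictly smaller. *)
Lemma singular_pencil rho (S : forall n, ('I_g -> 'M[R]_n) -> 'M[R]_(n, d) -> Prop) :
  (forall n (X : 'I_g -> 'M[R]_n) N, S n X N -> detbdry X N) ->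
  (forall n1 n2 (X1 : 'I_g -> 'M[R]_n1) (X2 : 'I_g -> 'M[R]_n2) N1 N2,
     S n1 X1 N1 -> S n2 X2 N2 ->
     S (n1 + n2)%N (fun j => block_mx (X1 j) 0 0 (X2 j)) (col_mx N1 N2)) ->
  (forall n (X : 'I_g -> 'M[R]_n) N, S n X N -> (\rank (wordmx k.+1 X N) < rho)%N) ->
  exists l (A : 'I_g -> 'M[R]_l), [/\ (0 < l)%N, pos_pencil A &
    forall n (X : 'I_g -> 'M[R]_n) N, S n X N ->
      exists2 V : 'M[R]_(n, l), V != 0 & V = \sum_j X j *m V *m A j].
Proof.
elim: rho S => [|rho IH] S Sb Sd Sr.
  (* No rank is below 0, so [S] is empty and the constant pencil 1 serves. *)
  exists 1%N, (fun=> 0); split=> // [|n X N /Sr //].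
  split=> [j|m Y V _]; first by rewrite trmx0.
  rewrite /pform big1 ?subr0 ?mxtrace_gram_ge0 // => j _.
  by rewrite mul0mx mxtrace0.
case: (pselect (exists n (X : 'I_g -> 'M[R]_n) N, S n X N /\
    \rank (wordmx k.+1 X N) = rho)); last first.
  move=> nS; apply: IH => // n X N SX; have := Sr _ _ _ SX; rewrite ltnS leq_eqVlt.
  by case/orP => // /eqP Xr; case: nS; exists n, X, N.
move=> [n0 [X0 [N0 [S0 r0]]]].
have dom n (X : 'I_g -> 'M[R]_n) N : S n X N ->
    (wordmx k.+1 X N <= wordmx k.+1 X0 N0)%MS.
  (* Stacking [(X, N)] under the pair of maximal rank stays in [S], so it cannot enlarge the row
     space. *)
  move=> SX; have := Sr _ _ _ (Sd _ _ _ _ _ _ S0 SX).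
  rewrite wordmx_block -addsmxE ltnS -r0 => le.
  have := mxrank_leqif_sup (addsmxSl (wordmx k.+1 X0 N0) (wordmx k.+1 X N)).
  move=> /geq_leqif; rewrite le => /esym sub.
  exact: submx_trans (addsmxSr _ _) sub.
have [l1 [A1 [F [pA1 V0 VE]]]] := supporting_pencil (Sb _ _ _ S0).
pose S' n (X : 'I_g -> 'M[R]_n) N := S n X N /\ wordmx k X N *m F = 0.
have [|||l2 [A2 [l20 [sA2 pA2] hS']]] := IH S'.
- by move=> n X N [/Sb].
- move=> n1 n2 X1 X2 N1 N2 [S1 F1] [S2 F2]; split; first exact: Sd.
  by rewrite wordmx_block mul_col_mx F1 F2 col_mx0.
(* With equal ranks the row spaces coincide, so [F] would also kill the word matrix at [(X0, N0)],
   contrary to [V0]. *)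
- move=> n X N [SX XF]; rewrite ltn_neqAle -{2}r0 mxrankS ?dom // andbT.
  apply: contra V0; rewrite -r0 (mxrank_leqif_sup (dom _ _ _ SX)) => /submxP [D DE].
  have [<- _] := wordmx_transfer (esym DE).
  by rewrite -mulmxA XF mulmx0.
exists (l1 + l2)%N, (fun j => block_mx (A1 j) 0 0 (A2 j)); split.
- by rewrite addn_gt0 l20 orbT.
- split=> [j|m Y V DY]; first by rewrite tr_block_mx !trmx0 pA1.1 sA2.
  by rewrite -[V]hsubmxK pform_row addr_ge0 ?pA2 // pA1.2.
move=> n X N SX; case: (eqVneq (wordmx k X N *m F) 0) => [XF|XF].
  have [V V00 VX] := hS' n X N (conj SX XF).
  exists (row_mx 0 V).
    by apply: contra_neq V00 => /(congr1 rsubmx); rewrite row_mxKr linear0.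
  rewrite sum_mul_row_block -VX big1 // => j _.
  by rewrite mulmx0 mul0mx.
have /submxP [D /esym DE] := dom _ _ _ SX.
have [E1 E2] := wordmx_transfer DE.
exists (row_mx (wordmx k X N *m F) 0).
  by apply: contra_neq XF => /(congr1 lsubmx); rewrite row_mxKl linear0.
rewrite sum_mul_row_block; congr row_mx; last by rewrite big1 // => j _; rewrite mulmx0 mul0mx.
rewrite -{1}E1 -mulmxA {1}VE mulmx_sumr; apply: eq_bigr => j _.
by rewrite !mulmxA -(mulmxA D) E2.
Qed.

End SingularPencil.

(** * Comparison with the invertibility set *)

Import numFieldNormedType.Exports.
Local Open Scope classical_set_scope.
Local Open Scope ring_scope.

Section Invset.
Variables (R : realType) (g d : nat) (p : 'M[freepoly R g]_d).
Hypothesis p0_unit : mxcoef p [::] \in unitmx.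

Lemma continuous_scaletup n (X : 'I_g -> 'M[R]_n) :
  continuous ((fun t => scaletup t X) : R -> {ptws 'I_g -> 'M[R]_n}).
Proof.
move=> t; apply/cvg_sup => j; apply: (@continuous_comp_initial) => {}t.
rewrite /continuous_at /comp /scaletup; apply: cvgZr_tmp; exact: cvg_id.
Qed.

Let cvx n (S : set ('I_g -> 'M[R]_n)) : Prop :=
  convex_set (S : set (convex_lmodType ('I_g -> 'M[R]_n))).

Lemma convex_setP n (S : set ('I_g -> 'M[R]_n)) : cvx S <->
  forall X Y t, S X -> S Y -> 0 <= t <= 1 -> S (fun j => t *: X j + (1 - t) *: Y j).
Proof.
split=> [cS X Y t SX SY /andP[t0 t1]|cS X Y t].
  have := cS X Y (Itv01 t0 t1); rewrite !inE => /(_ SX SY).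
  by congr S; apply/funext => j.
rewrite !inE => SX SY.
have := cS X Y (t%:num) SX SY; rewrite ge0 le1 => /(_ isT).
by congr S; apply/funext => j.
Qed.

(** Convexity keeps the segment from 0 to a point of the component inside it; conversely such a
    segment is a connected set through 0. *)
Lemma invset_stardom n : cvx (@invset R g d p n) -> @invset R g d p n = [set X | stardom p X].
Proof.
move=> /convex_setP cI.
have A0 : [set X : 'I_g -> 'M[R]_n | symtuple X /\ peval p X \in unitmx] (fun=> 0).
  by split; [move=> j; rewrite trmx0 | exact: peval0_unit].
apply/seteqP; split=> [X IX|X [sX uX]].
  have IA := @connected_component_sub {ptws 'I_g -> 'M[R]_n}
    [set X : 'I_g -> 'M[R]_n | symtuple X /\ peval p X \in unitmx] (fun=> 0).
  split=> [|t t01]; first by case: (IA _ IX).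
  have I0 : invset p (fun=> 0 : 'M[R]_n) by exact: connected_component_refl.
  have := cI _ _ _ IX I0 t01.
  rewrite (_ : (fun j => _) = scaletup t X); first by case/IA.
  by apply/funext => j; rewrite scaler0 addr0.
have conn := connected_continuous_connected (@segment_connected R 0 1)
  (continuous_subspaceT (@continuous_scaletup n X)).
apply: (connected_component_max _ _ conn).
- by exists 0; rewrite /= ?in_itv /= ?lexx ?ler01 // scaletup0.
- move=> _ [t t01 <-]; split; first exact: symtuple_scale.
  by apply: uX; move: t01; rewrite /= in_itv.
- by exists 1; rewrite /= ?in_itv /= ?lexx ?ler01 // scaletup1.
Qed.

End Invset.

(** * Positivity sets of monic pencils *)

Section Pencilset.
Variables (R : realType) (g : nat).

Lemma tensvec_dot a b (U V : 'M[R]_(b, a)) :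
  ((tensvec U)^T *m tensvec V) 0 0 = \tr (U^T *m V).
Proof.
rewrite mxE (reindex (fun x => @mxtens_index a b x)) /=; last first.
  by exists (@mxtens_unindex a b) => x _; rewrite ?mxtens_indexK ?mxtens_unindexK.
transitivity (\sum_x \sum_y U y x * V y x).
  rewrite pair_bigA; apply: eq_bigr => -[x y] _.
  by rewrite !mxE !mxtens_indexK.
by apply: eq_bigr => x _; rewrite mxE; apply: eq_bigr => y _; rewrite mxE.
Qed.

(** The minus sign reconciles [pform], built on [1 - sum], with [pencil], built on [1 + sum]. *)
Lemma peval_pencil_form l n (A : 'I_g -> 'M[R]_l) (X : 'I_g -> 'M[R]_n) V :
  symtuple A ->
  ((tensvec V)^T *m peval (pencil (fun j => - A j)) X *m tensvec V) 0 0 = pform A X V.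
Proof.
move=> sA; rewrite -mulmxA pformE -tensvec_dot peval_pencil mulmxDl mul1mx mulmx_suml.
have -> : tensvec (pencil_act A X V) = tensvec V + tensvec (- \sum_j X j *m V *m A j).
  by apply/matrixP => i k; rewrite !mxE.
rewrite -sumrN tensvec_sum; congr ((_ *m (_ + _)) _ _); apply: eq_bigr => j _.
by rewrite tensmx_tensvec linearN /= sA mulmxN.
Qed.

Lemma pencilsetP l n (A : 'I_g -> 'M[R]_l) (X : 'I_g -> 'M[R]_n) : symtuple A ->
  pencilset (fun j => - A j) X <->
  symtuple X /\ forall V : 'M[R]_(n, l), V != 0 -> 0 < pform A X V.
Proof.
move=> sA; split=> [[sX [_ pos]]|[sX pos]]; split=> //.
  move=> V V0; rewrite -peval_pencil_form //; apply: pos.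
  by apply: contra_neq V0 => V0; rewrite -[V]tensvecK V0; apply/matrixP => i j; rewrite !mxE.
split.
  rewrite peval_pencil linearD /= trmx1 linear_sum /=; congr (_ + _).
  by apply: eq_bigr => j _; rewrite trmx_tens linearN /= sA sX.
move=> v v0; rewrite -[v]vectensK peval_pencil_form //; apply: pos.
by apply: contra_neq v0 => v0; rewrite -[v]vectensK v0 tensvec0.
Qed.

Lemma pform_convex l n (A : 'I_g -> 'M[R]_l) (X Y : 'I_g -> 'M[R]_n) t V :
  pform A (fun j => t *: X j + (1 - t) *: Y j) V =
  t * pform A X V + (1 - t) * pform A Y V.
Proof.
have E : \sum_j \tr (A j *m (V^T *m (t *: X j + (1 - t) *: Y j) *m V)) =
    t * \sum_j \tr (A j *m (V^T *m X j *m V)) +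
    (1 - t) * \sum_j \tr (A j *m (V^T *m Y j *m V)).
  rewrite !mulr_sumr -big_split /=; apply: eq_bigr => j _.
  by rewrite mulmxDr mulmxDl mulmxDr mxtraceD -!(scalemxAl, scalemxAr) !mxtraceZ.
by rewrite /pform E; ring.
Qed.

Lemma pencilset_convex l n (B : 'I_g -> 'M[R]_l) : symtuple B ->
  convex_set (@pencilset R g l B n : set (convex_lmodType ('I_g -> 'M[R]_n))).
Proof.
move=> sB; pose A j := - B j.
have sA : symtuple A by move=> j; rewrite linearN /= sB.
have -> : B = fun j => - A j by apply/funext => j; rewrite opprK.
apply/convex_setP => X Y t /(pencilsetP _ sA)[sX pX] /(pencilsetP _ sA)[sY pY] /andP[t0 t1].
apply/pencilsetP => //; split=> [j|V V0]; first by rewrite linearD /= !linearZ /= sX sY.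
have := pX V V0; have := pY V V0; rewrite pform_convex; nra.
Qed.

End Pencilset.

(** A pencil nonnegative on the domain is strictly positive there, since points can be pushed
    outward. From a point outside, the ray meets the boundary where the pencil is singular, and
    affinity along the ray excludes positivity at the point. *)
Lemma stardom_has_LMI (R : realType) (g d : nat) (p : 'M[freepoly R g]_d) :
  mxcoef p [::] \in unitmx ->
  (forall n (X Y : 'I_g -> 'M[R]_n),
     stardom p X -> stardom p Y -> stardom p (fun j => 2^-1 *: (X j + Y j))) ->
  exists l (A : 'I_g -> 'M[R]_l), [/\ (0 < l)%N, symtuple A &
    forall n, [set X : 'I_g -> 'M[R]_n | stardom p X] = @pencilset R g l A n].
Proof.
move=> p0 mid.
pose k := (\max_(w <- mxsupp p) size w)%N.
have pk w : w \in mxsupp p -> (size w <= k.+1)%N.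
  by move=> ws; apply: leqW; apply: (@leq_bigmax_seq _ _ xpredT (fun w : word g => size w)).
have [|||l [A [l0 [sA pA] singA]]] := @singular_pencil R g d p p0 mid k pk
  (* The column count bounds every rank, so this strict bound holds for all boundary pairs. *)
  #|wordidx g d k.+1|.+1 (@detbdry R g d p).
- by [].
- move=> n1 n2 X1 X2 N1 N2 [c1 n10 e1] [c2 n20 e2]; split.
  + exact: starclos_block.
  + by apply: contra_neq n10 => /(congr1 usubmx); rewrite col_mxKu linear0.
  + by rewrite pact_block e1 e2 col_mx0.
- by move=> n X N _; rewrite ltnS rank_leq_col.
exists l, (fun j => - A j); split=> // [j|n]; first by rewrite linearN /= sA.
apply/seteqP; split=> X.
  move=> DX; apply/pencilsetP => //; split=> [|V V0]; first exact: DX.1.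
  have [e e0 De] := stardom_extend p0 DX.
  have := pA _ _ V De; rewrite pform_scale.
  have := mxtrace_gram_gt0 V0; nra.
move=> /(pencilsetP _ sA)[sX pos]; apply: contrapT => nX.
have [t /andP[t0 t1] [cX [N N0 XN]]] := stardom_exit p0 sX nX.
have [V V0 VE] := singA _ _ _ (And3 cX N0 XN).
have := pform_act0 VE; rewrite pform_scale.
have := pos V V0; have := mxtrace_gram_gt0 V0; nra.
Qed.

Theorem theorem1p4 (R : realType) (g d : nat) (hg : (0 < g)%N)
    (p : 'M[freepoly R g]_d)
    (hsym : psymmetric p)
    (hp0 : mxcoef p [::] \in unitmx)
    (hbnd : gradedset_bounded (invset p)) :
  gradedset_convex (invset p) <-> has_LMI (invset p).
Proof.
split=> [cI|[l [A [l0 sA IA]]] n n0]; last first.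
  by rewrite IA //; apply: pencilset_convex.
have IE n : (0 < n)%N -> @invset R g d p n = [set X | stardom p X].
  by move=> n0; apply: invset_stardom => //; apply: cI.
have [|l [A [l0 sA DA]]] := stardom_has_LMI hp0.
  (* Convexity says nothing about size 0, where every evaluation is trivially invertible. *)
  move=> [|n] X Y DX DY.
    split=> [j|t _]; first by apply/matrixP => -[].
    by apply/peval_unitP => N _; exact: flatmx0.
  have E (Z : 'I_g -> 'M[R]_n.+1) : stardom p Z = invset p Z by rewrite IE.
  rewrite !E in DX DY *.
  have h : (0 <= (2^-1 : R) <= 1)%R by apply/andP; split; lra.
  have := (convex_setP _).1 (cI n.+1 isT) X Y _ DX DY h.
  congr invset; apply/funext => j.
  by rewrite scalerDr; congr (_ + _ *: _); lra.
by exists l, A; split=> // n n0; rewrite IE.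
Qed.
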